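(* Let $X$ and $Y$ be Banach spaces and $T:X\to Y$ be a bounded linear operator. Then $$\tfrac12\operatorname{cont}_{\rho}(T)\le\omega(T^* )\le \operatorname{cont}_{\rho}(T)$$ and $$\tfrac12\operatorname{cont}_{\rho^*}(T^* )\le \omega(T)\le \operatorname{cont}_{\rho^*}(T^* ).$$
   Context: Banach spaces are real or complex; $B_X$ is the closed unit ball of $X$. Topologies: for a bounded $F\subset X^*$ put $q_F(x)=\sup\{|x^*(x)|:x^*\in F\}$, $x\in X$ (with $\sup\emptyset=0$). The topology $\rho$ on $X$ is the locally convex topology generated by the seminorms $q_F$, $F$ ranging over the weakly compact subsets of $B_{X^*}$. The topology $\rho^*$ on a dual space $Y^*$ is the locally convex topology generated by the seminorms $y^*\mapsto\sup\{|y^*(y)|:y\in F\}$, $F$ ranging over the weakly compact subsets of $B_Y$ (the Mackey topology of the pair $(Y^*,Y)$). For a bounded net $(z_\nu)_{\nu\in\Lambda}$ in a Banach space, $\operatorname{ca}(z_\nu)=\inf_{\nu_0\in\Lambda}\sup\{\|z_\nu-z_{\nu'}\|:\nu,\nu'\ge\nu_0\}$. For an operator $T:X\to Y$, $\operatorname{cont}_\rho(T)=\sup\{\operatorname{ca}(Tx_\nu):(x_\nu)\text{ is a }\rho\text{-Cauchy net in }B_X\}$. For $T^*:Y^*\to X^*$, $\operatorname{cont}_{\rho^*}(T^* )=\sup\{\operatorname{ca}(T^*y^*_\nu):(y^*_\nu)\text{ is a }\rho^*\text{-Cauchy net in }B_{Y^*}\}$. For nonempty subsets $A,B$ of a Banach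 space, $\widehat{\operatorname{d}}(A,B)=\sup_{a\in A}\inf_{b\in B}\|a-b\|$. The de Blasi measure of weak non-compactness of a bounded subset $A$ of a Banach space $Z$ is $\omega(A)=\inf\{\widehat{\operatorname{d}}(A,K):\emptyset\ne K\subset Z\text{ weakly compact}\}$. For an operator, $\omega(T)=\omega(T(B_X))$ (computed in $Y$) and $\omega(T^* )=\omega(T^*(B_{Y^*}))$ (computed in $X^*$). *)

(* Defs.v *)
From HB Require Import structures.
From mathcomp Require Import all_boot all_order all_algebra.
From mathcomp Require Import complex.
From mathcomp Require Import all_classical all_reals all_analysis.

Set Implicit Arguments.
Unset Strict Implicit.
Unset Printing Implicit Defensive.

Import Order.TTheory GRing.Theory Num.Theory.
Import numFieldNormedType.Exports.

Local Open Scope classical_set_scope.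
Local Open Scope ring_scope.

Variant scalar_kind := RealScalars | ComplexScalars.

Definition scalar_field (R : realType) (s : scalar_kind) : numFieldType :=
  match s with RealScalars => R | ComplexScalars => R[i] end.

(* The MathComp norm of a normed space over K takes its values in K, also for
   K = R[i]; [to_real] and [of_real] convert between those values and R. *)
Definition to_real (R : realType) (s : scalar_kind) : scalar_field R s -> R :=
  match s with RealScalars => fun x => x | ComplexScalars => fun z => complex.Re z end.

Definition of_real (R : realType) (s : scalar_kind) : R -> scalar_field R s :=
  match s with RealScalars => fun x => x | ComplexScalars => fun x => x%:C%C end.

Section Scalars.
Variables (R : realType) (s : scalar_kind).
Local Notation K := (scalar_field R s).

Lemma of_realK : cancel (@of_real R s) (@to_real R s).
Proof. by case: s. Qed.

Lemma to_realK (x : K) : 0 <= x -> of_real s (to_real x) = x.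
Proof.
case: s x => //= -[a b]; rewrite lecE /= => /andP[/eqP -> _].
by [].
Qed.

Lemma to_realD (x y : K) : to_real (x + y) = to_real x + to_real y.
Proof. by case: s x y => //= -[a b] [c d]. Qed.

Lemma of_realD (x y : R) : of_real s (x + y) = of_real s x + of_real s y.
Proof. by case: s => //=; rewrite rmorphD. Qed.

Lemma of_realM (x y : R) : of_real s (x * y) = of_real s x * of_real s y.
Proof. by case: s => //=; rewrite rmorphM. Qed.

Lemma le_of_real (x y : R) : (of_real s x <= of_real s y) = (x <= y).
Proof. by case: s => //=; rewrite lecR. Qed.

Lemma of_real0 : of_real s (0 : R) = 0.
Proof. by case: s. Qed.

Definition rnorm (X : normedZmodType K) (x : X) : R := to_real `|x|.

Section Rnorm.
Variable X : normedModType K.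
Implicit Types x y : X.

Lemma of_rnorm x : of_real s (rnorm x) = `|x|.
Proof. exact/to_realK/normr_ge0. Qed.

Lemma rnorm_ge0 x : 0 <= rnorm x.
Proof. by rewrite -le_of_real of_real0 of_rnorm. Qed.

Lemma rnorm0 : rnorm (0 : X) = 0.
Proof. by rewrite /rnorm normr0 -of_real0 of_realK. Qed.

Lemma rnormN x : rnorm (- x) = rnorm x.
Proof. by rewrite /rnorm normrN. Qed.

Lemma ler_rnormD x y : rnorm (x + y) <= rnorm x + rnorm y.
Proof. by rewrite -le_of_real of_realD !of_rnorm ler_normD. Qed.

Lemma rnormZ (a : K) x : rnorm (a *: x) = to_real `|a| * rnorm x.
Proof.
apply: (can_inj of_realK).
by rewrite of_realM !of_rnorm normrZ to_realK.
Qed.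

Lemma rnorm_eq0 x : rnorm x = 0 -> x = 0.
Proof. by move=> x0; apply/normr0_eq0; rewrite -of_rnorm x0 of_real0. Qed.

End Rnorm.

Definition unit_ball (X : normedModType K) : set X := [set x | rnorm x <= 1].

Definition bounded_map (X Y : normedModType K) (f : X -> Y) :=
  exists M : R, forall x, rnorm (f x) <= M * rnorm x.

End Scalars.

Lemma rnormM (R : realType) (s : scalar_kind) (a b : scalar_field R s) :
  rnorm (a * b : (scalar_field R s)^o) = rnorm (a : (scalar_field R s)^o) * rnorm (b : (scalar_field R s)^o).
Proof. exact: (@rnormZ R s (scalar_field R s)^o). Qed.

Section Dual.
Variables (R : realType) (s : scalar_kind).
Local Notation K := (scalar_field R s).
Variable X : normedModType K.

Definition dual_pred : {pred X -> K^o} :=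
  fun f => `[< linear f /\ bounded_map f >].

Lemma dual_predP (f : X -> K^o) :
  reflect (linear f /\ bounded_map f) (f \in dual_pred).
Proof. exact: asboolP. Qed.

Record dual : Type := Dual { dual_fun :> X -> K^o ; _ : dual_fun \in dual_pred }.

HB.instance Definition _ := [isSub for dual_fun].
HB.instance Definition _ := [Choice of dual by <:].

Lemma dual_submod_closed : submod_closed dual_pred.
Proof.
split.
  apply/dual_predP; split; first by move=> a x y /=; rewrite scaler0 addr0.
  by exists 0 => x; rewrite rnorm0 mul0r.
move=> a f g /dual_predP[lf [M fM]] /dual_predP[lg [N gN]].
have agE z : (a *: f + g) z = (a *: f z + g z : K^o) by [].
apply/dual_predP; split.
  by move=> b x y; rewrite !agE lf lg !scalerDr !scalerA (mulrC b) addrACA.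
exists (to_real `|a| * M + N) => x; rewrite agE.
apply: le_trans (ler_rnormD _ _) _.
rewrite mulrDl lerD // rnormZ -mulrA ler_wpM2l //.
exact: (@rnorm_ge0 R s K^o).
Qed.

HB.instance Definition _ :=
  GRing.isSubmodClosed.Build K (X -> K^o) dual_pred dual_submod_closed.
HB.instance Definition _ := [SubChoice_isSubLmodule of dual by <:].

Lemma dualP (f : dual) : linear f /\ bounded_map f.
Proof. exact/dual_predP/(valP f). Qed.

HB.instance Definition _ (f : dual) :=
  GRing.isLinear.Build K X K^o *:%R f (proj1 (dualP f)).

Lemma dualDE (f g : dual) x : (f + g) x = f x + g x.
Proof. by []. Qed.

Lemma dualZE (a : K) (f : dual) x : (a *: f) x = a * f x.
Proof. by []. Qed.

Lemma dual_inj (f g : dual) : f =1 g -> f = g.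
Proof. by move=> fg; apply/val_inj/funext. Qed.

Definition dual_norm (f : dual) : R :=
  sup [set rnorm (f x) | x in @unit_ball R s X].

Lemma dual_norm_set_ub (f : dual) :
  has_ubound [set rnorm (f x) | x in @unit_ball R s X].
Proof.
have [_ [M fM]] := dualP f; exists `|M| => _ [x x1 <-].
apply: le_trans (fM x) _; apply: le_trans (ler_norm _) _.
rewrite normrM (ger0_norm (rnorm_ge0 _)).
by rewrite -[leRHS]mulr1 ler_wpM2l.
Qed.

Lemma dual_norm_ub (f : dual) x : unit_ball x -> rnorm (f x) <= dual_norm f.
Proof. by move=> x1; apply: (ub_le_sup (dual_norm_set_ub f)); exists x. Qed.

Lemma dual_norm_le (f : dual) M :
  (forall x, unit_ball x -> rnorm (f x) <= M) -> dual_norm f <= M.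
Proof.
move=> fM; apply: ge_sup => [|_ [x x1 <-]]; last exact: fM.
by exists (rnorm (f 0)); exists 0 => //; rewrite /unit_ball /= rnorm0 ler01.
Qed.

Lemma dual_norm_ge0 f : 0 <= dual_norm f.
Proof.
apply: le_trans (rnorm_ge0 (f 0)) _.
by apply: dual_norm_ub; rewrite /unit_ball /= rnorm0 ler01.
Qed.

Lemma dual_norm_bound (f : dual) x : rnorm (f x) <= dual_norm f * rnorm x.
Proof.
have [->|x0] := eqVneq x 0; first by rewrite linear0 !rnorm0 mulr0.
have rx0 : 0 < rnorm x.
  rewrite lt_neqAle rnorm_ge0 andbT eq_sym.
  by apply: contra x0 => /eqP/rnorm_eq0/eqP.
have nK (r : R) : 0 <= r -> to_real `|of_real s r| = r.
  by move=> r0; rewrite ger0_norm ?of_realK // -of_real0 le_of_real.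
rewrite -ler_pdivrMr // mulrC -[(rnorm x)^-1]nK ?invr_ge0 ?(ltW rx0) //.
rewrite -rnormZ -linearZ; apply: dual_norm_ub.
by rewrite /unit_ball /= rnormZ nK ?invr_ge0 ?(ltW rx0) // mulVf ?gt_eqF.
Qed.

Lemma dual_normD f g : dual_norm (f + g) <= dual_norm f + dual_norm g.
Proof.
apply: dual_norm_le => x x1; rewrite dualDE.
by apply: le_trans (ler_rnormD _ _) _; rewrite lerD ?dual_norm_ub.
Qed.

Lemma dual_normZ_le (a : K) f : dual_norm (a *: f) <= to_real `|a| * dual_norm f.
Proof.
apply: dual_norm_le => x x1; rewrite dualZE rnormM ler_wpM2l ?dual_norm_ub //.
exact: (@rnorm_ge0 R s K^o).
Qed.

Lemma dual_normZ (a : K) f : dual_norm (a *: f) = to_real `|a| * dual_norm f.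
Proof.
apply/eqP; rewrite eq_le dual_normZ_le /=.
have [->|a0] := eqVneq a 0.
  by rewrite normr0 -of_real0 of_realK mul0r dual_norm_ge0.
have ra0 : 0 < to_real `|a|.
  rewrite lt_neqAle (@rnorm_ge0 R s K^o) andbT eq_sym.
  by apply: contra a0 => /eqP/(@rnorm_eq0 R s K^o)/eqP.
have := dual_normZ_le a^-1 (a *: f).
rewrite scalerA mulVf // scale1r -(ler_pM2l ra0) mulrA.
have -> : to_real `|a| * to_real `|a^-1| = 1 :> R.
  have := rnormM a a^-1; rewrite mulfV // => <-.
  by rewrite /rnorm normr1; case: (s).
by rewrite mul1r.
Qed.

Lemma dual_norm0_eq0 f : dual_norm f = 0 -> f = 0.
Proof.
move=> f0; apply: dual_inj => x; apply: (@rnorm_eq0 R s K^o).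
by apply/eqP; rewrite eq_le rnorm_ge0 -(mul0r (rnorm x)) -f0 dual_norm_bound.
Qed.

Let norm (f : dual) : K := of_real s (dual_norm f).

Let ler_norm_norm f g : norm (f + g) <= norm f + norm g.
Proof. by rewrite -of_realD le_of_real dual_normD. Qed.

Let norm_scale (a : K) f : norm (a *: f) = `|a| * norm f.
Proof. by rewrite /norm dual_normZ of_realM to_realK. Qed.

Let norm_eq0 f : norm f = 0 -> f = 0.
Proof.
by rewrite -(of_real0 R s) => /(can_inj (@of_realK R s))/dual_norm0_eq0.
Qed.

HB.instance Definition _ :=
  Lmodule_isNormed.Build K dual ler_norm_norm norm_scale norm_eq0.

Lemma rnorm_dual (f : dual) : rnorm f = dual_norm f.
Proof. exact: of_realK. Qed.

End Dual.

Section Weak.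
Variables (R : realType) (s : scalar_kind).
Local Notation K := (scalar_field R s).
Variable X : normedModType K.

Definition weak : Type :=
  initial_topology (fun (x : X) => (fun f : dual X => f x) : {ptws dual X -> K^o}).

HB.instance Definition _ := Topological.on weak.

Definition weakly_compact (A : set X) := compact (A : set weak).

End Weak.

Section Seminorms.
Variables (R : realType) (s : scalar_kind).
Local Notation K := (scalar_field R s).

Record seminorm (V : lmodType K) := Seminorm {
  seminorm_fun :> V -> R ;
  seminormD : forall x y, seminorm_fun (x + y) <= seminorm_fun x + seminorm_fun y ;
  seminormZ : forall (a : K) x,
    seminorm_fun (a *: x) = to_real `|a| * seminorm_fun x }.

(* V with (the uniformity of) the locally convex topology generated by the family p: a subset of
   V * V is an entourage iff it contains {(x, y) | p_i(x - y) < e, i \in J} for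
   some finite J and some e > 0. *)
Definition seminorm_space (V : lmodType K) (I : Type) (p : I -> seminorm V) : Type :=
  V.

Section Uniform.
Local Open Scope relation_scope.
Variables (V : lmodType K) (I : Type) (p : I -> seminorm V).

Definition seminorm_ball (J : set I) (e : R) : set (V * V) :=
  [set xy | forall i, J i -> p i (xy.1 - xy.2) < e].

Definition seminorm_entourage : set_system (V * V) :=
  [set E | exists J, exists2 e, finite_set J /\ 0 < e & seminorm_ball J e `<=` E].

Lemma seminorm0 (q : seminorm V) : q 0 = 0.
Proof.
have := seminormZ q 0 0.
by rewrite scale0r normr0 -(of_real0 R s) of_realK mul0r.
Qed.

Lemma seminormBC (q : seminorm V) x y : q (x - y) = q (y - x).
Proof.
rewrite -(opprB y x) -(scaleN1r (y - x)) seminormZ normrN normr1.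
have -> : @to_real R s 1 = 1 by case: (s).
by rewrite mul1r.
Qed.

Let ent_filter : Filter seminorm_entourage.
Proof.
split.
- by exists set0; exists 1 => //; split=> //; exact: finite_set0.
- move=> A B [J [e [fJ e0] JA]] [L [d [fL d0] LB]].
  exists (J `|` L); exists (Num.min e d).
    by split; [rewrite finite_setU|rewrite lt_min e0].
  move=> xy xyP; split.
    by apply: JA => i Ji; have := xyP i (or_introl Ji); rewrite lt_min => /andP[].
  by apply: LB => i Li; have := xyP i (or_intror Li); rewrite lt_min => /andP[].
- by move=> A B AB [J [e Je JA]]; exists J; exists e => //; exact: subset_trans AB.
Qed.

Let ent_refl A : seminorm_entourage A -> diagonal `<=` A.
Proof.
move=> [J [e [_ e0] JA]] [x y] xy; apply: JA => i _ /=.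
by rewrite (xy : x = y) subrr seminorm0.
Qed.

Let ent_inv A : seminorm_entourage A -> seminorm_entourage A^-1.
Proof.
move=> [J [e Je JA]]; exists J; exists e => // -[x y] xyP; apply: JA => i Ji /=.
by rewrite seminormBC; exact: xyP.
Qed.

Let ent_split A : seminorm_entourage A ->
  exists2 B, seminorm_entourage B & B \; B `<=` A.
Proof.
move=> [J [e [fJ e0] JA]]; exists (seminorm_ball J (e / 2)).
  by exists J; exists (e / 2) => //; rewrite divr_gt0.
move=> [x z] [y /= xy yz]; apply: JA => i Ji /=.
rewrite -(subrKA y) (le_lt_trans (seminormD _ _ _)) // [ltRHS](splitr e).
by rewrite ltrD ?xy ?yz.
Qed.

HB.instance Definition _ := Choice.on (seminorm_space p).
HB.instance Definition _ := @isUniform.Build (seminorm_space p)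
  seminorm_entourage ent_filter ent_refl ent_inv ent_split.

End Uniform.
End Seminorms.

(* Nets are functions on a directed set; [x @ tails L] is the filter of the sets
   in which the net x eventually lies. *)
Record directedSet := DirectedSet {
  dcarrier :> Type ;
  dle : dcarrier -> dcarrier -> Prop ;
  dle_refl : forall a, dle a a ;
  dle_trans : forall a b c, dle a b -> dle b c -> dle a c ;
  dpoint : dcarrier ;
  dle_directed : forall a b, exists c, dle a c /\ dle b c }.

Definition tails (L : directedSet) : set_system L :=
  filter_from [set: L] (fun n0 => [set n | dle n0 n]).

Section Measures.
Variables (R : realType) (s : scalar_kind).
Local Notation K := (scalar_field R s).
Local Open Scope ereal_scope.

(* The quantities below are finite for bounded nets, sets and operators; taking
   their values in \bar R keeps the suprema and infima unconditional. *)
Definition ca (X : normedModType K) (L : directedSet) (z : L -> X) : \bar R :=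
  ereal_inf [set ereal_sup [set (rnorm (z n.1 - z n.2))%:E |
    n in [set n : L * L | dle n0 n.1 /\ dle n0 n.2]] | n0 in [set: L]].

Definition cont (X Y : normedModType K) (I : Type) (p : I -> seminorm X)
    (T : X -> Y) : \bar R :=
  ereal_sup [set c | exists (L : directedSet) (x : L -> X),
    [/\ forall n, unit_ball (x n),
        cauchy ((x : L -> seminorm_space p) @ @tails L) &
        c = ca (T \o x)]].

Definition dhat (X : normedModType K) (A B : set X) : \bar R :=
  ereal_sup [set ereal_inf [set (rnorm (a - b))%:E | b in B] | a in A].

Definition omega (Z : normedModType K) (A : set Z) : \bar R :=
  ereal_inf [set dhat A C | C in [set C | C !=set0 /\ weakly_compact C]].

Definition omega_op (X Y : normedModType K) (T : X -> Y) : \bar R :=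
  omega (T @` @unit_ball R s X).

End Measures.

Section SupSeminorm.
Variables (R : realType) (s : scalar_kind).
Local Notation K := (scalar_field R s).
Variables (V : lmodType K) (I : Type) (F : set I) (e : I -> V -> K^o).
Hypothesis e_lin : forall i, linear (e i).
Hypothesis e_ub : forall v, has_ubound [set rnorm (e i v) | i in F].

Let q v : R := sup [set rnorm (e i v) | i in F].

Let q_le v M : 0 <= M -> (forall i, F i -> rnorm (e i v) <= M) -> q v <= M.
Proof.
move=> M0 eM; have [F0|/set0P[i Fi]] := eqVneq F set0.
  by rewrite /q F0 image_set0 sup0.
by apply: ge_sup => [|_ [j Fj <-]]; [exists (rnorm (e i v)), i|exact: eM].
Qed.

Let q_ub v i : F i -> rnorm (e i v) <= q v.
Proof. by move=> Fi; apply: ub_le_sup => //; exists i. Qed.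

Let q_ge0 v : 0 <= q v.
Proof.
have [F0|/set0P[i Fi]] := eqVneq F set0; first by rewrite /q F0 image_set0 sup0.
exact: le_trans (rnorm_ge0 _) (q_ub v Fi).
Qed.

Let eD i u v : e i (u + v) = e i u + e i v.
Proof. by have := e_lin i 1 u v; rewrite !scale1r. Qed.

Let eZ i a v : e i (a *: v) = a *: e i v.
Proof.
have e0 : e i 0 = 0.
  have := eD i 0 0; rewrite addr0 => /esym/eqP.
  by rewrite addrC -subr_eq0 addrK => /eqP.
by have := e_lin i a v 0; rewrite e0 !addr0.
Qed.

Lemma sup_seminormD u v : q (u + v) <= q u + q v.
Proof.
apply: q_le => [|i Fi]; first by rewrite addr_ge0.
by rewrite eD (le_trans (ler_rnormD _ _)) // lerD ?q_ub.
Qed.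

Lemma sup_seminormZ (a : K) v : q (a *: v) = to_real `|a| * q v.
Proof.
have a_ge0 (b : K) : 0 <= to_real `|b| by exact: (@rnorm_ge0 R s K^o).
have qZ_le (b : K) w : q (b *: w) <= to_real `|b| * q w.
  apply: q_le => [|i Fi]; first by rewrite mulr_ge0.
  by rewrite eZ rnormZ ler_wpM2l ?q_ub.
apply/eqP; rewrite eq_le qZ_le /=.
have [->|a0] := eqVneq a 0.
  by rewrite normr0 -[X in to_real X](of_real0 R s) of_realK mul0r.
have aV : to_real `|a| * to_real `|a^-1| = 1 :> R.
  have := rnormM a a^-1; rewrite mulfV // => <-.
  by rewrite /rnorm normr1; case: (s).
rewrite -[leRHS]mul1r -aV -mulrA ler_wpM2l //.
by have := qZ_le a^-1 (a *: v); rewrite scalerA mulVf // scale1r.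
Qed.

End SupSeminorm.

Section Rho.
Variables (R : realType) (s : scalar_kind).
Local Notation K := (scalar_field R s).

Definition wc_in_ball (X : normedModType K) (F : set X) :=
  weakly_compact F /\ F `<=` @unit_ball R s X.

Variable X : normedModType K.

(* In the reals [sup set0 = 0], which is the convention wanted for F empty. *)
Definition q_rho (F : {F : set (dual X) | wc_in_ball F}) (x : X) : R :=
  sup [set rnorm (f x) | f in sval F].

Definition q_rho_star (F : {F : set X | wc_in_ball F}) (f : dual X) : R :=
  sup [set rnorm (f x) | x in sval F].

Lemma q_rho_ub (F : {F : set (dual X) | wc_in_ball F}) (x : X) :
  has_ubound [set rnorm (f x) | f in sval F].
Proof.
case: F => F [_ FB] /=; exists (rnorm x) => _ [f /FB f1 <-].
rewrite (le_trans (dual_norm_bound f x)) // -[leRHS]mul1r ler_wpM2r ?rnorm_ge0 //.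
by rewrite -rnorm_dual.
Qed.

Lemma q_rho_star_ub (F : {F : set X | wc_in_ball F}) (f : dual X) :
  has_ubound [set rnorm (f x) | x in sval F].
Proof.
case: F => F [_ FB] /=; exists (dual_norm f) => _ [x /FB x1 <-].
exact: dual_norm_ub.
Qed.

Lemma eval_linear (x : X) : linear (fun f : dual X => f x : K^o).
Proof. by []. Qed.

Definition rho (F : {F : set (dual X) | wc_in_ball F}) : seminorm X :=
  @Seminorm R s X (q_rho F)
    (sup_seminormD (fun f : dual X => proj1 (dualP f)) (q_rho_ub F))
    (sup_seminormZ (fun f : dual X => proj1 (dualP f)) (q_rho_ub F)).

Definition rho_star (F : {F : set X | wc_in_ball F}) : seminorm (dual X) :=
  @Seminorm R s (dual X) (q_rho_star F)
    (sup_seminormD eval_linear (q_rho_star_ub F))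
    (sup_seminormZ eval_linear (q_rho_star_ub F)).

End Rho.

Definition cont_rho (R : realType) (s : scalar_kind)
    (X Y : normedModType (scalar_field R s)) (T : X -> Y) : \bar R :=
  cont (@rho R s X) T.

Definition cont_rho_star (R : realType) (s : scalar_kind)
    (X Y : normedModType (scalar_field R s)) (S : dual Y -> dual X) : \bar R :=
  cont (@rho_star R s Y) S.

Section Adjoint.
Variables (R : realType) (s : scalar_kind).
Local Notation K := (scalar_field R s).
Variables (X Y : normedModType K) (T : {linear X -> Y}) (hT : bounded_map T).

Lemma adjoint_subproof (f : dual Y) : (f \o T : X -> K^o) \in @dual_pred R s X.
Proof.
apply/dual_predP; split; first by move=> a x y /=; rewrite !linearP.
have [M TM] := hT; exists (dual_norm f * M) => x /=.
rewrite (le_trans (dual_norm_bound f _)) // -mulrA ler_wpM2l //.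
exact: dual_norm_ge0.
Qed.

Definition adjoint (f : dual Y) : dual X := Dual (adjoint_subproof f).

End Adjoint.

(* Main.v *)
Require Import Defs.
From mathcomp Require Import all_boot all_order all_algebra.
From mathcomp Require Import complex.
From mathcomp Require Import all_classical all_reals all_analysis.
From mathcomp Require Import ring lra.

(** Both pairs of inequalities are one statement about a linear map S : V -> W
    and a bounded set A in a Banach space Z, where V maps linearly and without
    increasing norms to the dual of Z by j, and the norm of S v is the supremum
    of |j v (a)| over a in A.  For the first pair Z is the dual of X, V = X with
    j the evaluation, S = T and A = T^*(B); for the second Z = Y, V is the dual
    of Y with j the identity, S = T^* and A = T(B).  The seminorms on V are
    q_F (j v) for F weakly compact in the unit ball of Z, where q_F is the
    supremum over F of the absolute value.

    Half of cont is at most omega ([cont_le_omega]): if every point of A is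
    within c of a weakly compact set C, the part of C near A is bounded, hence a
    multiple of an admissible F.  For v = x - y with x, y in the unit ball and
    q_F (j v) small, |j v (a)| exceeds a small number by at most c times the
    norm of v, that is by at most 2 c.

    omega is at most cont ([omega_le_cont]): if cont is below c, some admissible
    F has |S v| <= c |v| + C q_F (j v); otherwise points of the unit ball tending
    to 0, alternating with 0, would form a Cauchy net on which S oscillates by
    more than c ([lt_cont]).  So for a in A the functional v |-> j v (a) is
    dominated by a sum of two seminorms, and by Hahn-Banach ([hb_extension]) it
    is the sum of a part of norm at most c and a functional Phi on the dual of Z
    with |Phi| <= C q_F.  If Phi is evaluation at a point k of Z, then k is
    within c of a, and k lies in the bipolar of C F.

    What remains is that every linear Phi on the dual of Z with |Phi| <= C q_F is
    an evaluation ([rho_star_bounded_eval]).  This is Krein's theorem (closed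
    absolutely convex hulls of weakly compact sets are weakly compact) in dual
    form, and it also shows that the bipolar of C F is weakly compact.  If Phi
    is at distance more than eps from the evaluations, Helly's theorem gives
    functionals g_n in the unit ball with Phi g_n = eps that are small on any
    prescribed finite set.  Following the proof of Simons' inequality, the g_n
    are chosen one after the other so that the partial sums of the series of
    2^-(n+1) g_n nearly minimise q_F, while points e_n of F nearly attain q_F on
    these partial sums.  Minimality forces all the normalised tails t_n of the
    series to satisfy |t_n f| >= 2 kappa, kappa > 0, at a weak cluster point f of
    the e_n; but t_n e_m tends to 0 for every m, so a weak-star limit of the t_n
    vanishes on all the e_m and hence at f. *)

Import Order.TTheory GRing.Theory Num.Theory.
Import numFieldNormedType.Exports.

Set Implicit Arguments.
Unset Strict Implicit.
Unset Printing Implicit Defensive.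

Local Open Scope classical_set_scope.
Local Open Scope ring_scope.

(** * Scalars, norms and seminorms *)

Section Scalars.
Context {R : realType} {s : scalar_kind}.
Local Notation K := (scalar_field R s).

Lemma of_real1 : of_real s (1 : R) = 1.
Proof. by case: s. Qed.

Lemma lt_of_real (x y : R) : (of_real s x < of_real s y) = (x < y).
Proof. by rewrite !lt_neqAle le_of_real (inj_eq (can_inj (@of_realK R s))). Qed.

Lemma of_realN (r : R) : of_real s (- r) = - of_real s r.
Proof. by case: s => //=; rewrite rmorphN. Qed.

Lemma to_real0 : to_real (0 : K) = 0 :> R.
Proof. by rewrite -(of_real0 R s) of_realK. Qed.

Lemma to_realN (a : K) : to_real (- a) = - to_real a :> R.
Proof. by apply/eqP; rewrite -addr_eq0 -to_realD addNr to_real0. Qed.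

Lemma to_realB (a b : K) : to_real (a - b) = to_real a - to_real b :> R.
Proof. by rewrite to_realD to_realN. Qed.

Lemma to_realM (r : R) (a : K) : to_real (of_real s r * a) = r * to_real a :> R.
Proof. by case: s a => //= -[a b] /=; rewrite mul0r subr0. Qed.

Lemma to_real_norm_of_real (r : R) : to_real `|of_real s r| = `|r|.
Proof.
case: s => //=.
by rewrite expr0n addr0 sqrtr_sqr.
Qed.

Lemma to_real_le_norm (a : K) : to_real a <= to_real `|a| :> R.
Proof.
case: s a => [a|[a b]] /=; first exact: ler_norm.
rewrite (le_trans (ler_norm a)) // -sqrtr_sqr ler_wsqrtr //.
by rewrite lerDl sqr_ge0.
Qed.

Lemma rnorm_ge0K (a : K) : 0 <= to_real `|a| :> R.
Proof. exact: (@rnorm_ge0 R s K^o). Qed.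

Lemma rnorm_of_real (r : R) : rnorm (of_real s r : K^o) = `|r|.
Proof. exact: to_real_norm_of_real. Qed.

Lemma to_real_normM (a b : K) :
  to_real `|a * b| = to_real `|a| * to_real `|b| :> R.
Proof. by rewrite normrM -{1}(to_realK (normr_ge0 a)) to_realM. Qed.

Lemma to_real_normV (a : K) : to_real `|a^-1| = (to_real `|a|)^-1 :> R.
Proof.
have [->|a0] := eqVneq a 0; first by rewrite invr0 normr0 to_real0 invr0.
have E : to_real `|a| * to_real `|a^-1| = 1 :> R.
  by rewrite -to_real_normM mulfV // normr1 -of_real1 of_realK.
have na0 : to_real `|a| != 0 :> R.
  by apply/eqP => na0; move/eqP: E; rewrite na0 mul0r eq_sym oner_eq0.
by apply: (mulfI na0); rewrite E mulfV.
Qed.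

Lemma rnormBC (X : normedModType K) (x y : X) : rnorm (x - y) = rnorm (y - x).
Proof. by rewrite -opprB rnormN. Qed.

Lemma ler_rnormB (X : normedModType K) (x y : X) :
  rnorm (x - y) <= rnorm x + rnorm y.
Proof. by rewrite -(rnormN y) ler_rnormD. Qed.

Lemma ler_rnorm_distD (X : normedModType K) (z x y : X) :
  rnorm (x - y) <= rnorm (x - z) + rnorm (z - y).
Proof. by rewrite -(subrKA z) ler_rnormD. Qed.

Lemma rnorm_realZ (X : normedModType K) (r : R) (x : X) :
  0 <= r -> rnorm (of_real s r *: x) = r * rnorm x.
Proof. by move=> r0; rewrite rnormZ to_real_norm_of_real ger0_norm. Qed.

Lemma zero_in_unit_ball (Z : normedModType K) : unit_ball (0 : Z).
Proof. by rewrite /unit_ball /= rnorm0 ler01. Qed.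

Section LinearMaps.
Variables (U V : lmodType K) (f : U -> V).
Hypothesis f_lin : linear f.

Lemma linear_addE u v : f (u + v) = f u + f v.
Proof. by have := f_lin 1 u v; rewrite !scale1r. Qed.

Lemma linear_zeroE : f 0 = 0.
Proof.
have := linear_addE 0 0; rewrite addr0 => /esym/eqP.
by rewrite -subr_eq0 addrK => /eqP.
Qed.

Lemma linear_scaleE a u : f (a *: u) = a *: f u.
Proof. by have := f_lin a u 0; rewrite linear_zeroE !addr0. Qed.

Lemma linear_oppE u : f (- u) = - f u.
Proof. by rewrite -(scaleN1r u) linear_scaleE scaleN1r. Qed.

Lemma linear_subE u v : f (u - v) = f u - f v.
Proof. by rewrite linear_addE linear_oppE. Qed.

End LinearMaps.

Definition norm_seminorm (X : normedModType K) : seminorm X :=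
  Seminorm (@ler_rnormD R s X) (@rnormZ R s X).

Lemma seminorm_ge0 (V : lmodType K) (p : seminorm V) x : 0 <= p x.
Proof.
have : p (x - x) <= p x + p (- x) by exact: seminormD.
rewrite -(scaleN1r x) seminormZ normrN normr1.
have -> : to_real (1 : K) = 1 :> R by rewrite -of_real1 of_realK.
by rewrite mul1r scaleN1r subrr seminorm0; lra.
Qed.

Lemma seminorm_realZ (V : lmodType K) (p : seminorm V) (r : R) x :
  0 <= r -> p (of_real s r *: x) = r * p x.
Proof. by move=> r0; rewrite seminormZ to_real_norm_of_real ger0_norm. Qed.

End Scalars.

(** * The Hahn-Banach theorem *)

Section HahnBanach.
Context {R : realType} {s : scalar_kind}.
Local Notation K := (scalar_field R s).

(** Homogeneity only for real scalars: real and complex spaces are then treated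
    together, and the functional over K is recovered from its real part. *)
Definition sublinear (V : lmodType K) (p : V -> R) :=
  (forall x y, p (x + y) <= p x + p y) /\
  (forall r x, 0 < r -> p (of_real s r *: x) = r * p x).

Lemma sublinear0 (V : lmodType K) (p : V -> R) : sublinear p -> p 0 = 0.
Proof.
by move=> [_ /(_ 2 0 ltac:(lra))]; rewrite scaler0; lra.
Qed.

Lemma sublinearN (V : lmodType K) (p : V -> R) x :
  sublinear p -> - p (- x) <= p x.
Proof.
move=> sp; have := sp.1 x (- x); rewrite subrr sublinear0 //; lra.
Qed.

Lemma seminorm_sublinear (V : lmodType K) (p : seminorm V) : sublinear p.
Proof.
split; first exact: seminormD.
by move=> r x /ltW r0; rewrite seminorm_realZ.
Qed.

(** The three hypotheses on the family cover both uses: the infimum of a chain,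
    and the infimum over the parameter of an infimal convolution. *)
Lemma inf_sublinear (V : lmodType K) (I : Type) (F : I -> V -> R) (i0 : I) :
  (forall x, has_lbound [set F i x | i in setT]) ->
  (forall i k x y, exists l, F l (x + y) <= F i x + F k y) ->
  (forall r i x, 0 < r -> exists l, F l (of_real s r *: x) <= r * F i x) ->
  sublinear (fun x => inf [set F i x | i in setT]).
Proof.
move=> lbF FD FZ.
have infF i x : inf [set F i x | i in setT] <= F i x.
  by apply: ge_inf => //; exists i.
have infP x a : (forall i, a <= F i x) -> a <= inf [set F i x | i in setT].
  move=> aF; apply: lb_le_inf; first by exists (F i0 x), i0.
  by move=> _ [i _ <-].
have ZD r x : 0 < r ->
    inf [set F i (of_real s r *: x) | i in setT] <=
    r * inf [set F i x | i in setT].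
  move=> r0; rewrite -ler_pdivrMl //; apply: infP => i.
  rewrite ler_pdivrMl //; have [l] := FZ r i x r0.
  exact: le_trans (infF _ _).
split=> [x y|r x r0].
  rewrite -lerBlDr; apply: (infP) => i; rewrite lerBlDl -lerBlDr.
  apply: (infP) => k; rewrite lerBlDl; have [l] := FD i k x y.
  exact: le_trans (infF _ _).
apply/eqP; rewrite eq_le ZD //= -ler_pdivlMl //.
have := ZD r^-1 (of_real s r *: x); rewrite invr_gt0 => /(_ r0).
by rewrite scalerA -of_realM mulVf ?gt_eqF // of_real1 scale1r.
Qed.

(** The infimal convolution of p and h along j.  A linear functional below it is
    below p, and at - j u it is at most h u: one construction gives both the
    one-step perturbation and the extension from a subspace. *)
Lemma inf_convolution (U V : lmodType K) (j : U -> V) (C : set U)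
    (p : V -> R) (h : U -> R) : linear j -> sublinear p -> C 0 ->
  (forall u v, C u -> C v -> C (u + v)) ->
  (forall r u, 0 < r -> C u -> C (of_real s r *: u)) ->
  (forall u v, C u -> C v -> h (u + v) <= h u + h v) ->
  (forall r u, 0 < r -> C u -> h (of_real s r *: u) = r * h u) ->
  (forall u, C u -> - p (j u) <= h u) ->
  exists q : V -> R, [/\ sublinear q, forall x, q x <= p x &
    forall x u, C u -> q x <= p (x + j u) + h u].
Proof.
move=> lj sp C0 CD CZ hD hZ ph.
pose F (u : {u : U | C u}) x := p (x + j (sval u)) + h (sval u).
have h0 : h 0 = 0.
  by have := hZ 2 0 ltac:(lra) C0; rewrite scaler0; lra.
have lbF x : has_lbound [set F i x | i in setT].
  exists (- p (- x)) => _ [[u Cu] _ <-]; rewrite /F /=.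
  have := ph u Cu; have := sp.1 (x + j u) (- x); rewrite addrAC subrr add0r; lra.
have qle x u (Cu : C u) : inf [set F i x | i in setT] <= p (x + j u) + h u.
  by apply: ge_inf => //; exists (exist _ u Cu).
exists (fun x => inf [set F i x | i in setT]); split=> //.
  apply: inf_sublinear => //.
  - by exists 0.
  - move=> [u Cu] [v Cv] x y; exists (exist _ (u + v) (CD _ _ Cu Cv)).
    rewrite /F /= (linear_addE lj) addrACA; have := hD _ _ Cu Cv.
    by have := sp.1 (x + j u) (y + j v); lra.
  - move=> r [u Cu] x r0; exists (exist _ (of_real s r *: u) (CZ _ _ r0 Cu)).
    by rewrite /F /= (linear_scaleE lj) -scalerDr sp.2 // hZ // mulrDr.
by move=> x; have := qle x 0 C0; rewrite (linear_zeroE lj) h0 !addr0.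
Qed.

(** Convolving q with - q along the ray through y gives a sublinear map below q
    whose value at x is at most q (x + y) - q y; by minimality q x is at most
    that. *)
Lemma minimal_sublinear_additive (V : lmodType K) (q : V -> R) : sublinear q ->
  (forall q', sublinear q' -> (forall x, q' x <= q x) -> forall x, q x <= q' x) ->
  forall x y, q (x + y) = q x + q y.
Proof.
move=> sq qmin x y; apply/eqP; rewrite eq_le sq.1 /=.
pose C := [set of_real s t | t in [set t : R | 0 <= t]] : set K^o.
have qC (t : R) : 0 <= t -> q (of_real s t *: y) = t * q y.
  rewrite le0r => /orP[/eqP ->|]; last by move/sq.2 => ->.
  by rewrite of_real0 scale0r mul0r sublinear0.
have [|||||||q' [sq' q'q q'C]] :=
  @inf_convolution K^o V (fun t => t *: y) C q (fun t => - q (t *: y)) _ sq.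
- by move=> a u v; rewrite scalerDl scalerA.
- by exists 0 => //=; rewrite of_real0.
- move=> _ _ [u u0 <-] [v v0 <-]; exists (u + v); first exact: addr_ge0.
  by rewrite of_realD.
- move=> r _ r0 [u u0 <-]; exists (r * u); last by rewrite of_realM.
  by rewrite /= mulr_ge0 // ltW.
- move=> _ _ [u /= u0 <-] [v /= v0 <-]; rewrite -of_realD !qC ?addr_ge0 //; lra.
- move=> r _ r0 [u /= u0 <-]; rewrite -scalerA sq.2 //; lra.
- by [].
have := q'C x 1; rewrite scale1r => /(_ _)/(le_trans (qmin _ sq' q'q x)).
rewrite lerBrDr; apply.
by exists 1 => /=; rewrite ?ler01 // of_real1.
Qed.

(** Zorn's lemma applied to the sublinear maps below p, ordered downwards: a
    minimal one is linear. *)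
Lemma sublinear_minorant (V : lmodType K) (p : V -> R) : sublinear p ->
  exists L : V -> R, [/\ forall x y, L (x + y) = L x + L y,
    forall r x, L (of_real s r *: x) = r * L x & forall x, L x <= p x].
Proof.
move=> sp.
pose T := {q : V -> R | sublinear q /\ forall x, q x <= p x}.
pose le (q1 q2 : T) := `[< forall x, sval q2 x <= sval q1 x >].
pose mk q (sq : sublinear q) (qp : forall x, q x <= p x) : T :=
  exist _ q (conj sq qp).
pose t0 := mk p sp (fun x => lexx _).
have [L Lmax] : exists L, premaximal le L.
  apply: (ZL_preorder t0) => [q|q1 q2 q3 /asboolP q12 /asboolP q23|A totA].
  - exact/asboolP.
  - by apply/asboolP => x; exact: le_trans (q23 x) (q12 x).
  have [[q0 Aq0]|A0] := pselect (A !=set0); last first.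
    exists t0 => q Aq.
    by exfalso; apply: A0; exists q.
  pose F (q : {q : T | A q}) : V -> R := sval (sval q).
  have lbF x : has_lbound [set F i x | i in setT].
    exists (- p (- x)) => _ [[[q [sq qp]] Aq] _ <-]; rewrite /F /=.
    by apply: le_trans (sublinearN x sq); rewrite lerN2.
  have sF : sublinear (fun x => inf [set F i x | i in setT]).
    apply: inf_sublinear => //.
    + by exists q0.
    + move=> [q1 A1] [q2 A2] x y.
      have [/asboolP q12|/asboolP q21] := totA _ _ A1 A2.
        exists (exist _ q2 A2); rewrite /F /=.
        by rewrite (le_trans ((svalP q2).1.1 x y)) // lerD2r.
      exists (exist _ q1 A1); rewrite /F /=.
      by rewrite (le_trans ((svalP q1).1.1 x y)) // lerD2l.
    + move=> r [q Aq] x r0; exists (exist _ q Aq); rewrite /F /=.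
      by rewrite (svalP q).1.2.
  have infF q x : A q -> inf [set F i x | i in setT] <= sval q x.
    by move=> Aq; apply: ge_inf => //; exists (exist _ q Aq).
  have Fp x : inf [set F i x | i in setT] <= p x.
    by apply: le_trans (infF q0 x Aq0) _; exact: (svalP q0).2.
  exists (mk _ sF Fp) => q Aq; apply/asboolP => x.
  exact: infF.
have [sL Lp] := svalP L.
have LD x y : sval L (x + y) = sval L x + sval L y.
  apply: minimal_sublinear_additive => // q sq qL.
  have qp z : q z <= p z by exact: le_trans (Lp z).
  have /asboolP := Lmax (mk q sq qp) (introT (asboolP _) qL).
  by [].
(* Additivity gives negative scalars, which sublinearity leaves open. *)
have LN x : sval L (- x) = - sval L x.
  by have := LD x (- x); rewrite subrr sublinear0 //; lra.
exists (sval L); split=> // r x.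
have [r0|r0|->] := ltgtP r 0; last 2 first.
- exact: sL.2.
- by rewrite of_real0 scale0r mul0r sublinear0.
rewrite -[r]opprK of_realN scaleNr LN sL.2 ?oppr_gt0 //; lra.
Qed.

(** In the complex case the functional is x |-> L x - i L (i x). *)
Lemma linear_of_real_part (V : lmodType K) (L : V -> R) :
  (forall x y, L (x + y) = L x + L y) ->
  (forall r x, L (of_real s r *: x) = r * L x) ->
  exists Phi : V -> K^o, linear Phi /\ forall x, to_real (Phi x) = L x.
Proof.
case: s V L => V L LD LZ.
  by exists L; split=> // a x y; rewrite LD (LZ a x).
have L0 : L 0 = 0 by have := LZ 0 0; rewrite scaler0 mul0r.
have LN x : L (- x) = - L x by have := LD x (- x); rewrite subrr L0; lra.
exists (fun x => Complex (L x) (- L (Complex 0 1 *: x))); split=> // -[a b] x y.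
rewrite !LD !scalerDr.
have E z : L (Complex a b *: z) = a * L z + b * L (Complex 0 1 *: z).
  rewrite -!LZ -LD scalerA -scalerDl /=; congr (L (_ *: _)).
  by apply/eqP; rewrite eq_complex /=; apply/andP; split; apply/eqP; ring.
have Ei z : L (Complex 0 1 *: (Complex a b *: z)) =
    a * L (Complex 0 1 *: z) - b * L z.
  rewrite -!LZ -LN -LD -scaleNr !scalerA -scalerDl /=; congr (L (_ *: _)).
  by apply/eqP; rewrite eq_complex /=; apply/andP; split; apply/eqP; ring.
rewrite LD E Ei /GRing.scale /=.
by apply/eqP; rewrite eq_complex /=; apply/andP; split; apply/eqP; ring.
Qed.

(** Multiply x by a scalar of modulus 1 that makes Phi x nonnegative. *)
Lemma le_norm_of_real_part (V : lmodType K) (p : seminorm V) (Phi : V -> K^o) :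
  linear Phi -> (forall x, to_real (Phi x) <= p x) ->
  forall x, rnorm (Phi x) <= p x.
Proof.
move=> lPhi Pp x.
have [Px0|Px0] := eqVneq (Phi x) 0; first by rewrite Px0 rnorm0 seminorm_ge0.
have nPx0 : `|Phi x| != 0 by rewrite normr_eq0.
pose a : K := `|Phi x| / Phi x.
have Pa : Phi (a *: x) = `|Phi x|.
  by rewrite (linear_scaleE lPhi) /GRing.scale /= /a divfK.
have := Pp (a *: x); rewrite Pa seminormZ /a normrM normfV normr_id divff //.
by rewrite -of_real1 of_realK mul1r.
Qed.

(** Hahn-Banach in the form of a splitting: a functional dominated by a sum of
    two seminorms, the second one living on E, differs from the restriction of a
    functional dominated by p2 by at most p1.  With p1 = 0 this is extension,
    with j the identity it is the decomposition of a functional. *)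
Theorem hb_extension (U E : lmodType K) (j : U -> E) (chi : U -> K^o)
    (p1 : seminorm U) (p2 : seminorm E) : linear j -> linear chi ->
  (forall u, rnorm (chi u) <= p1 u + p2 (j u)) ->
  exists Phi : E -> K^o, [/\ linear Phi, forall e, rnorm (Phi e) <= p2 e &
    forall u, rnorm (chi u - Phi (j u)) <= p1 u].
Proof.
move=> lj lchi chip.
pose h u := p1 u - to_real (chi u).
have [//|//|u v _ _|r u /ltW r0 _|u _|L0 [sL0 L0p L0j]] :=
    @inf_convolution U E j setT p2 h lj (seminorm_sublinear p2) I.
- by rewrite /h (linear_addE lchi) to_realD; have := seminormD p1 u v; lra.
- by rewrite /h (linear_scaleE lchi) to_realM seminorm_realZ //; lra.
- rewrite /h; have := to_real_le_norm (chi u); have := chip u.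
  by rewrite /rnorm; lra.
have [L [LD LZ LL0]] := sublinear_minorant sL0.
have [Phi [lPhi PhiL]] := linear_of_real_part LD LZ.
exists Phi; split=> //.
  by apply: le_norm_of_real_part => // e; rewrite PhiL (le_trans (LL0 e)).
apply: (@le_norm_of_real_part U p1 (fun u => chi u - Phi (j u))) => [a u v|u].
  by rewrite lj lPhi lchi scalerBr opprD addrACA.
rewrite to_realB -to_realN -(linear_oppE lPhi) PhiL.
have := L0j (- j u) u I; have := LL0 (- j u).
by rewrite addNr seminorm0 /h; lra.
Qed.

End HahnBanach.

(** * Limits along ultrafilters and weak compactness *)

Lemma ultra_fmap (I J : Type) (f : I -> J) (U : set_system I) :
  UltraFilter U -> UltraFilter (f @ U).
Proof.
move=> UU; split=> [|G GG UG]; first exact: fmap_proper_filter.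
rewrite eqEsubset; split => // A GA.
have [//|nA] := in_ultra_setVsetC (f @^-1` A) UU.
have GnA : G (~` A) by exact: UG.
by have /filter_ex[x []] : G (A `&` ~` A) by exact: filterI.
Qed.

Section UltraLimits.
Context {R : realType} {s : scalar_kind}.
Local Notation K := (scalar_field R s).

Section Filter.
Variables (I : Type) (U : set_system I).
Context {PU : ProperFilter U}.
Implicit Types (g h : I -> K^o) (l m : K^o).

(** Limits of scalars are expressed through the real-valued norm, in which all
    the estimates below are written. *)
Definition fcvg h l := forall e : R, 0 < e -> U [set i | rnorm (h i - l) < e].

Lemma fcvg_le h l m M : fcvg h l -> U [set i | rnorm (h i - m) <= M] ->
  rnorm (l - m) <= M.
Proof.
move=> hl hM; apply/ler_addgt0Pr => e e0.
have [i [/= il iM]] := filter_ex (filterI (hl e e0) hM).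
have := ler_rnorm_distD (h i) l m; rewrite (rnormBC l (h i)); lra.
Qed.

Lemma fcvg_ge h l m M : fcvg h l -> U [set i | M <= rnorm (h i - m)] ->
  M <= rnorm (l - m).
Proof.
move=> hl hM; apply/ler_addgt0Pr => e e0.
have [i [/= il iM]] := filter_ex (filterI (hl e e0) hM).
have := ler_rnorm_distD l (h i) m; lra.
Qed.

Lemma fcvg_unique h l m : fcvg h l -> fcvg h m -> l = m.
Proof.
move=> hl hm; apply/eqP; rewrite -subr_eq0; apply/eqP/rnorm_eq0/eqP.
rewrite eq_le rnorm_ge0 andbT; apply/ler_addgt0Pr => e e0; rewrite add0r.
by apply: (fcvg_le hl); apply: filterS (hm e e0) => i /= /ltW.
Qed.

Lemma fcvg_linear a g h l m : fcvg g l -> fcvg h m ->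
  fcvg (fun i => a *: g i + h i) (a *: l + m).
Proof.
move=> gl hm e e0; set c := to_real `|a| + 1.
have a0 : 0 <= to_real `|a| by exact: rnorm_ge0K.
have c0 : 0 < c by rewrite /c; lra.
have e2 : 0 < e / 2 by lra.
have ec : 0 < e / 2 / c by rewrite divr_gt0.
apply: filterS (filterI (gl _ ec) (hm _ e2)) => i /= [gi hi].
rewrite opprD addrACA -scalerBr (le_lt_trans (ler_rnormD _ _)) //.
rewrite [ltRHS](splitr e) ler_ltD // rnormZ.
apply: (@le_trans _ _ (c * (e / 2 / c))); last by rewrite mulrC divfK ?gt_eqF.
rewrite ler_pM ?rnorm_ge0 //; last exact: ltW.
by rewrite /c; lra.
Qed.

End Filter.

Lemma ultra_bounded_real (I : Type) (U : set_system I) (h : I -> R) M :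
  UltraFilter U -> U [set i | `|h i| <= M] ->
  exists l, forall e, 0 < e -> U [set i | `|h i - l| < e].
Proof.
move=> UU hM; pose S := [set a | U [set i | a <= h i]].
have hS : has_sup S.
  split.
    by exists (- M); apply: filterS hM => i /=; rewrite ler_norml => /andP[].
  exists M => a Sa; have [i [/=]] := filter_ex (filterI Sa hM).
  rewrite ler_norml => ai /andP[_ iM]; exact: le_trans iM.
exists (sup S) => e e0.
have [a Sa ae] := sup_adherent e0 hS.
have [b|nb] := in_ultra_setVsetC [set i | sup S + e <= h i] UU.
  have := @sup_upper_bound _ _ hS (sup S + e) b; lra.
apply: filterS (filterI Sa nb) => i /= [ai /negP]; rewrite -ltNge => ie.
by rewrite ltr_norml; apply/andP; split; lra.
Qed.

(** For real scalars re is the identity and im vanishes, so that compactness of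
    bounded sets of scalars follows in both cases from that of real intervals. *)
Lemma scalar_coordinates : exists re im : K^o -> R,
  (forall z, `|re z| <= rnorm z /\ `|im z| <= rnorm z) /\
  forall a b, exists l, forall z, rnorm (z - l) <= `|re z - a| + `|im z - b|.
Proof.
rewrite /rnorm; case: s => /=.
  exists id, (fun=> 0); split=> [z|a b]; first by rewrite normr0.
  by exists a => z; rewrite lerDl.
have le_abs (a b : R) : `|a| <= Num.sqrt (a ^+ 2 + b ^+ 2).
  by rewrite -sqrtr_sqr ler_wsqrtr // lerDl sqr_ge0.
exists (fun z => complex.Re z), (fun z => complex.Im z); split=> [[a b]|a b] /=.
  by split; rewrite ?le_abs // addrC le_abs.
exists (Complex a b) => -[c d] /=.
rewrite -[leRHS]ger0_norm ?addr_ge0 // -sqrtr_sqr ler_wsqrtr //.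
rewrite [leRHS]sqrrD.
by rewrite !real_normK ?num_real // lerD2r lerDl mulrn_wge0 // mulr_ge0.
Qed.

Lemma ultra_bounded (I : Type) (U : set_system I) (h : I -> K^o) M :
  UltraFilter U -> U [set i | rnorm (h i) <= M] -> exists l, fcvg U h l.
Proof.
move=> UU hM; have [re [im [hle hl]]] := scalar_coordinates.
have [|a ha] := @ultra_bounded_real _ U (re \o h) M UU.
  by apply: filterS hM => i /=; apply: le_trans; exact: (hle _).1.
have [|b hb] := @ultra_bounded_real _ U (im \o h) M UU.
  by apply: filterS hM => i /=; apply: le_trans; exact: (hle _).2.
have [l lP] := hl a b; exists l => e e0; have e2 : 0 < e / 2 by lra.
apply: filterS (filterI (ha _ e2) (hb _ e2)) => i /= [].
by have := lP (h i); lra.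
Qed.

(** The Banach-Alaoglu theorem, for functionals on an arbitrary vector space. *)
Lemma ultra_linear_limit (I : Type) (U : set_system I) (V : lmodType K)
    (f : I -> V -> K^o) (p : V -> R) : UltraFilter U ->
  (forall i, linear (f i)) -> (forall x, U [set i | rnorm (f i x) <= p x]) ->
  exists Phi : V -> K^o, [/\ linear Phi, forall x, rnorm (Phi x) <= p x &
    forall x, fcvg U (f ^~ x) (Phi x)].
Proof.
move=> UU lf fp.
have /choice[Phi PhiP] : forall x, exists l, fcvg U (f ^~ x) l.
  by move=> x; exact: ultra_bounded (fp x).
exists Phi; split=> // [a x y|x].
  have Pl : fcvg U (f ^~ (a *: x + y)) (a *: Phi x + Phi y).
    move=> e e0.
    by apply: filterS (fcvg_linear a (PhiP x) (PhiP y) e0) => i /=; rewrite lf.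
  exact: fcvg_unique (PhiP _) Pl.
have := @fcvg_le _ U _ (f ^~ x) (Phi x) 0 (p x) (PhiP x).
rewrite subr0; apply.
by apply: filterS (fp x) => i /=; rewrite subr0.
Qed.

End UltraLimits.

Section WeakCompactness.
Context {R : realType} {s : scalar_kind}.
Local Notation K := (scalar_field R s).
Variable Z : normedModType K.

Lemma cvg_fcvg (I : Type) (U : set_system I) (h : I -> K^o) (l : K^o) :
  Filter U -> h @ U --> l <-> fcvg U h l.
Proof.
move=> FU; split=> [/cvgrPdist_lt hl e e0|hl].
  have e0' : 0 < of_real s e by rewrite -(of_real0 R s) lt_of_real.
  apply: filterS (hl _ e0') => i /=.
  by rewrite -of_rnorm lt_of_real rnormBC.
apply/cvgrPdist_lt => e e0.
have te : e = of_real s (to_real e) by rewrite to_realK // ltW.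
move: e0; rewrite te -(of_real0 R s) lt_of_real => e0.
by apply: filterS (hl _ e0) => i /=; rewrite -of_rnorm lt_of_real rnormBC.
Qed.

(** The weak topology is the initial one for the evaluation of functionals, so
    an ultrafilter converges weakly as soon as each functional converges. *)
Lemma weakly_compactP (A : set Z) : weakly_compact A <->
  forall U : set_system Z, UltraFilter U -> U A ->
    exists2 z, A z & forall g : dual Z, fcvg U g (g z).
Proof.
have cvgE (U : set_system Z) (z : Z) : UltraFilter U ->
    ((U : set_system (weak Z)) --> (z : weak Z)) <->
    forall g : dual Z, fcvg U g (g z).
  move=> UU; pose ev (x : Z) : {ptws dual Z -> K^o} := fun f : dual Z => f x.
  have evP : {ptws, ev @ U --> ev z} <-> forall g : dual Z, fcvg U g (g z).
    have := @pointwise_cvgP (dual Z) K^o (ev @ U) (ev z) _.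
    by move=> ->; split=> Uz g; apply/cvg_fcvg; exact: Uz.
  rewrite -evP; split=> [Uz|evz].
    by apply: cvg_trans (cvg_app _ Uz) _; exact: initial_continuous.
  move=> N [_ [[B oB <-] Bz BN]].
  apply: (@filterS _ U _ (ev @^-1` B)) => //.
  by apply: evz; exact: open_nbhs_nbhs.
rewrite /weakly_compact compact_ultra; split=> Ac U UU UA.
  by have [z [Az /cvgE Uz]] := Ac U UU UA; exists z.
by have [z Az Uz] := Ac U UU UA; exists z; split=> //; apply/cvgE.
Qed.

End WeakCompactness.

(** * Functionals on the dual and Helly's theorem *)

Section SeminormOperations.
Context {R : realType} {s : scalar_kind}.
Local Notation K := (scalar_field R s).
Variable V : lmodType K.
Implicit Types p q : seminorm V.

Definition zero_seminorm : seminorm V.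
Proof.
by exists (fun=> 0) => [x y|a x]; [rewrite addr0|rewrite mulr0].
Defined.

Definition add_seminorm p q : seminorm V.
Proof.
exists (fun x => p x + q x) => [x y|a x]; last by rewrite !seminormZ mulrDr.
by rewrite addrACA lerD ?seminormD.
Defined.

Definition scale_seminorm (c : R) p : 0 <= c -> seminorm V.
Proof.
move=> c0; exists (fun x => c * p x) => [x y|a x].
  by rewrite -mulrDr ler_wpM2l ?seminormD.
by rewrite seminormZ mulrCA.
Defined.

End SeminormOperations.

Section Dual.
Context {R : realType} {s : scalar_kind}.
Local Notation K := (scalar_field R s).
Variable Z : normedModType K.

Lemma dual_of_bounded (Phi : Z -> K^o) M : linear Phi ->
  (forall x, rnorm (Phi x) <= M * rnorm x) ->
  exists g : dual Z, forall x, g x = Phi x.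
Proof.
move=> lPhi PhiM.
have PhiP : Phi \in @dual_pred R s Z by apply/dual_predP; split=> //; exists M.
by exists (Dual PhiP).
Qed.

Lemma dual_le (g : dual Z) M :
  0 <= M -> (forall x, rnorm (g x) <= M * rnorm x) -> rnorm g <= M.
Proof.
move=> M0 gM; rewrite rnorm_dual; apply: dual_norm_le => x x1.
by apply: le_trans (gM x) _; rewrite -[leRHS]mulr1 ler_wpM2l.
Qed.

Lemma dual_bound (g : dual Z) x : rnorm (g x) <= rnorm g * rnorm x.
Proof. by rewrite rnorm_dual; exact: dual_norm_bound. Qed.

Lemma dual_realZE (r : R) (g : dual Z) x :
  0 <= r -> rnorm ((of_real s r *: g) x) = r * rnorm (g x).
Proof. by move=> r0; rewrite -(@rnorm_realZ R s K^o). Qed.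

(** Split t |-> t |z| on the scalars against the norm of Z along t |-> t z. *)
Lemma norming_functional (z : Z) :
  exists g : dual Z, rnorm g <= 1 /\ rnorm (g z) = rnorm z.
Proof.
have [|||Phi [lPhi Phi1 Phiz]] := @hb_extension R s K^o Z (fun t => t *: z)
    (fun t => t *: (of_real s (rnorm z) : K^o)) (zero_seminorm _) (norm_seminorm Z).
- by move=> a t u; rewrite scalerDl scalerA.
- by move=> a t u; rewrite scalerDl scalerA.
- move=> t /=; rewrite add0r !rnormZ rnorm_of_real.
  by rewrite (ger0_norm (rnorm_ge0 z)).
have [g gPhi] : exists g : dual Z, forall x, g x = Phi x.
  by apply: (@dual_of_bounded _ 1) => // x; rewrite mul1r; exact: Phi1.
exists g; split; first by apply: dual_le => // x; rewrite mul1r gPhi; exact: Phi1.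
have := Phiz 1; rewrite !scale1r => Phiz0.
have /rnorm_eq0/eqP : rnorm (of_real s (rnorm z) - Phi z : K^o) = 0.
  by apply/eqP; rewrite eq_le rnorm_ge0 andbT.
rewrite subr_eq0 gPhi => /eqP <-.
by rewrite rnorm_of_real ger0_norm ?rnorm_ge0.
Qed.

Lemma norm_le_dual (z : Z) M : 0 <= M ->
  (forall g : dual Z, rnorm (g z) <= M * rnorm g) -> rnorm z <= M.
Proof.
move=> M0 zM; have [g [g1 <-]] := norming_functional z.
by apply: le_trans (zM g) _; rewrite -[leRHS]mulr1 ler_wpM2l.
Qed.

Definition eval_seminorm (e : Z) : seminorm (dual Z).
Proof.
exists (fun g : dual Z => rnorm (g e)) => [g h|a g]; first exact: ler_rnormD.
by rewrite dualZE rnormM.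
Defined.

Definition eval_sum_seminorm (es : seq Z) : seminorm (dual Z) :=
  foldr (fun e p => add_seminorm (eval_seminorm e) p) (zero_seminorm _) es.

Lemma le_eval_sum (es : seq Z) (g : dual Z) e :
  e \in es -> rnorm (g e) <= eval_sum_seminorm es g.
Proof.
elim: es => //= e' es IH; rewrite inE => /predU1P[->|/IH ee].
  by rewrite lerDl seminorm_ge0.
by rewrite (le_trans ee) // lerDr rnorm_ge0.
Qed.

(** psi vanishes on the kernel of the evaluation at e. *)
Lemma eval_of_kernel (psi : dual Z -> K^o) (e : Z) C : linear psi ->
  (forall g : dual Z, rnorm (psi g) <= C * rnorm (g e)) ->
  exists c : K, forall g : dual Z, psi g = g (c *: e).
Proof.
move=> lpsi psiC.
have [[g0 g0e]|ne] := pselect (exists g0 : dual Z, g0 e != 0); last first.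
  exists 0 => g; rewrite scale0r linear0; apply/rnorm_eq0/eqP.
  rewrite eq_le rnorm_ge0 andbT (le_trans (psiC g)) //.
  have [->|gee] := eqVneq (g e) 0; first by rewrite rnorm0 mulr0.
  by exfalso; apply: ne; exists g.
exists (psi g0 / g0 e) => g; rewrite linearZ /=.
pose g' := g - (g e / g0 e) *: g0.
have g'e : g' e = 0.
  by rewrite /g' -scaleNr addrC dualDE dualZE mulNr divfK // addNr.
have := psiC g'; rewrite g'e rnorm0 mulr0 => psig'.
have /rnorm_eq0/eqP : rnorm (psi g') = 0.
  by apply/eqP; rewrite eq_le psig' rnorm_ge0.
rewrite /g' linear_subE // linear_scaleE // subr_eq0 => /eqP ->.
by rewrite /GRing.scale /= mulrAC [RHS]mulrAC [psi g0 * _]mulrC.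
Qed.

(** Induction on the points: the splitting theorem isolates the contribution of
    each of them, a multiple of the evaluation at that point. *)
Lemma eval_of_eval_sum_bound (es : seq Z) C (phi : dual Z -> K^o) : 0 <= C ->
  linear phi -> (forall g, rnorm (phi g) <= C * eval_sum_seminorm es g) ->
  exists z : Z, forall g : dual Z, phi g = g z.
Proof.
move=> C0; elim: es phi => [|e es IH] phi lphi phiC.
  exists 0 => g; rewrite linear0; apply/rnorm_eq0/eqP.
  by rewrite eq_le rnorm_ge0 andbT (le_trans (phiC g)) //= mulr0.
have [//|g|Phi [lPhi PhiC phiPhi]] := @hb_extension R s (dual Z) (dual Z) id phi
    (scale_seminorm (eval_seminorm e) C0)
    (scale_seminorm (eval_sum_seminorm es) C0) _ lphi.
  by rewrite /= -mulrDr; exact: phiC.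
have [z Phiz] := IH Phi lPhi PhiC.
have [|c phic] := @eval_of_kernel (fun g => phi g - Phi g) e C _ phiPhi.
  by move=> a g h; rewrite lphi lPhi scalerBr opprD addrACA.
exists (c *: e + z) => g.
by rewrite (linear_addE (dualP g).1) -phic -Phiz subrK.
Qed.

(** If no g in the unit ball had phi g = eps and small values on es, then by
    homogeneity |phi| <= eps |.| + (eps / eta) sum_es, and removing from phi the
    part dominated by the sum, an evaluation, would leave norm at most eps. *)
Lemma helly (phi : dual Z -> K^o) (eps : R) : linear phi -> 0 < eps ->
  (forall z : Z, exists g : dual Z, eps * rnorm g < rnorm (phi g - g z)) ->
  forall (es : seq Z) (eta : R), 0 < eta -> exists g : dual Z,
    [/\ rnorm g <= 1, phi g = of_real s eps &
        forall e, e \in es -> rnorm (g e) <= eta].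
Proof.
move=> lphi eps0 phifar es eta eta0; apply: contrapT => nog.
have C0 : 0 <= eps / eta by rewrite divr_ge0 // ltW.
have [//|g|Phi [lPhi PhiC phiPhi]] := @hb_extension R s (dual Z) (dual Z) id phi
    (scale_seminorm (norm_seminorm _) (ltW eps0))
    (scale_seminorm (eval_sum_seminorm es) C0) _ lphi.
  rewrite leNgt; apply/negP => /= gphi; apply: nog.
  set a := rnorm (phi g) in gphi.
  have q0 : 0 <= eps / eta * eval_sum_seminorm es g.
    by rewrite mulr_ge0 // seminorm_ge0.
  have n0 : 0 <= eps * rnorm g by rewrite mulr_ge0 ?rnorm_ge0 // ltW.
  have a0 : 0 < a by lra.
  have phig0 : phi g != 0 by apply: contraTneq a0 => g0; rewrite /a g0 rnorm0 ltxx.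
  have Ea : to_real `|of_real s eps / phi g| = eps / a.
    by rewrite to_real_normM to_real_normV to_real_norm_of_real gtr0_norm.
  exists ((of_real s eps / phi g) *: g); split.
  - rewrite rnormZ Ea mulrAC ler_pdivrMr // mul1r; lra.
  - by rewrite linear_scaleE // /GRing.scale /= divfK.
  - move=> e ees; rewrite rnormZ Ea mulrAC ler_pdivrMr //.
    have := le_eval_sum g ees; rewrite -(ler_pM2l eps0) => ege.
    apply: le_trans ege _.
    have -> : eps * eval_sum_seminorm es g =
        eta * (eps / eta * eval_sum_seminorm es g).
      by field; exact: lt0r_neq0.
    by rewrite ler_pM2l //; lra.
have [z Phiz] := eval_of_eval_sum_bound C0 lPhi PhiC.
have [g] := phifar z; rewrite ltNge => /negP; apply.
by rewrite -Phiz; exact: phiPhi.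
Qed.

End Dual.

(** * Krein's theorem in dual form *)

Section HalfPowers.
Variable R : realType.

Definition half_pow (n : nat) : R := 2^-1 ^+ n.

Lemma half_pow0 : half_pow 0 = 1.
Proof. by rewrite /half_pow expr0. Qed.

Lemma half_powS n : half_pow n.+1 = half_pow n / 2.
Proof. by rewrite /half_pow exprSr. Qed.

Lemma half_pow_gt0 n : 0 < half_pow n.
Proof. by rewrite exprn_gt0 // invr_gt0. Qed.

Lemma half_pow_le n m : (n <= m)%N -> half_pow m <= half_pow n.
Proof.
by move=> nm; rewrite ler_wiXn2l // ?invr_ge0 // invf_le1 // ler1n.
Qed.

Lemma half_pow_small (c e : R) : 0 < e -> exists n, c * half_pow n < e.
Proof.
move=> e0; have [c0|c0] := ltP 0 c; last first.
  by exists 0%N; rewrite half_pow0; lra.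
have half1 : `|2^-1 : R| < 1 by rewrite ger0_norm ?invr_ge0 //; lra.
have ec : 0 < e / c by rewrite divr_gt0.
have /cvgrPdist_lt/(_ _ ec) := cvg_expr half1.
move=> /filter_ex[n /=]; rewrite sub0r normrN => hn.
exists n; rewrite mulrC -ltr_pdivlMr //; apply: le_lt_trans hn.
exact: ler_norm.
Qed.

End HalfPowers.

Section RhoStar.
Context {R : realType} {s : scalar_kind}.
Local Notation K := (scalar_field R s).
Variable Z : normedModType K.
Variable F : {F : set Z | wc_in_ball F}.
Implicit Types g : dual Z.

Lemma rho_star_ub g z : sval F z -> rnorm (g z) <= rho_star F g.
Proof. by move=> Fz; apply: (ub_le_sup (q_rho_star_ub F g)); exists z. Qed.

Lemma rho_star_le g M : 0 <= M -> (forall z, sval F z -> rnorm (g z) <= M) ->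
  rho_star F g <= M.
Proof.
move=> M0 gM; have [F0|/set0P[z Fz]] := eqVneq (sval F) set0.
  by rewrite /= /q_rho_star F0 image_set0 sup0.
by apply: ge_sup => [|_ [x Fx <-]]; [exists (rnorm (g z)), z|exact: gM].
Qed.

Lemma rho_star_le_norm g : rho_star F g <= rnorm g.
Proof.
apply: rho_star_le => [|z /(svalP F).2 z1]; first exact: rnorm_ge0.
by rewrite rnorm_dual dual_norm_ub.
Qed.

Lemma rho_star_nonempty g : 0 < rho_star F g -> exists z, sval F z.
Proof.
move=> g0; apply: contrapT => nF; suff : rho_star F g <= 0 by lra.
by apply: rho_star_le => // z Fz; exfalso; apply: nF; exists z.
Qed.

Lemma rho_star_adherent z0 g e : sval F z0 -> 0 < e ->
  exists2 z, sval F z & rho_star F g <= rnorm (g z) + e.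
Proof.
move=> Fz0 e0.
have hs : has_sup [set rnorm (g z) | z in sval F].
  by split; [exists (rnorm (g z0)), z0|exact: q_rho_star_ub].
have [_ [z Fz <-] zg] := sup_adherent e0 hs.
by exists z => //=; rewrite -lerBlDr ltW.
Qed.

End RhoStar.

Section MackeyArens.
Context {R : realType} {s : scalar_kind}.
Local Notation K := (scalar_field R s).
Variable Z : normedModType K.
Variable F : {F : set Z | wc_in_ball F}.
Variables (phi : dual Z -> K^o) (C : R).
Hypothesis C0 : 0 < C.
Hypothesis phi_lin : linear phi.
Hypothesis phi_le : forall g, rnorm (phi g) <= C * rho_star F g.

Local Notation q := (rho_star F).
Local Notation h := (@half_pow R).
Local Notation kr := (@of_real R s).

Section Far.
Variable eps : R.
Hypothesis eps0 : 0 < eps.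
Hypothesis phi_far :
  forall z : Z, exists g : dual Z, eps * rnorm g < rnorm (phi g - g z).

(** The convex set in which the n-th functional is chosen.  It decreases with n
    and is closed, so that it also contains the normalised tails. *)
Definition slice (n : nat) (e : nat -> Z) : set (dual Z) :=
  [set g | [/\ rnorm g <= 1, phi g = kr eps &
    forall j, (j < n)%N -> rnorm (g (e j)) <= h n]].

(** v n is the n-th partial sum of the series of 2^-(k+1) g k.  Candidates are
    compared with weight 2^-n because that is the total weight of the terms
    still to come. *)
Lemma minimizing_sequence (kappa : R) : 0 < kappa ->
  exists (g v : nat -> dual Z) (e : nat -> Z), v 0%N = 0 /\ forall n, [/\
    v n.+1 = v n + kr (h n.+1) *: g n,
    slice n e (g n),
    forall g', slice n e g' ->
      q (v n + kr (h n) *: g n) <= q (v n + kr (h n) *: g') + kappa * h n ^+ 2,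
    sval F (e n) &
    q (v n.+1) <= rnorm (v n.+1 (e n)) + h n].
Proof.
move=> kappa0.
(* The recursion carries the list of the points e j chosen so far. *)
pose cand n (es : seq Z) : set (dual Z) := [set g | [/\ rnorm g <= 1,
  phi g = kr eps & forall e, e \in es -> rnorm (g e) <= h n]].
have [g0 [_ phig0 _]] := helly phi_lin eps0 phi_far [::] ltr01.
have [z0 Fz0] : exists z, sval F z.
  apply: (@rho_star_nonempty _ _ _ F g0).
  have := phi_le g0; rewrite phig0 rnorm_of_real (gtr0_norm eps0) => ge.
  by rewrite -(pmulr_rgt0 _ C0); apply: lt_le_trans ge.
have step (x : nat * (dual Z * seq Z)) : exists y : dual Z * Z,
  [/\ cand x.1 x.2.2 y.1,
    forall g', cand x.1 x.2.2 g' ->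
      q (x.2.1 + kr (h x.1) *: y.1) <=
        q (x.2.1 + kr (h x.1) *: g') + kappa * h x.1 ^+ 2,
    sval F y.2 &
    q (x.2.1 + kr (h x.1.+1) *: y.1) <=
      rnorm ((x.2.1 + kr (h x.1.+1) *: y.1) y.2) + h x.1].
  case: x => n [v es] /=.
  have hi : has_inf [set q (v + kr (h n) *: g') | g' in cand n es].
    split; last by exists 0 => _ [g' _ <-]; exact: seminorm_ge0.
    have [g gc] := helly phi_lin eps0 phi_far es (half_pow_gt0 R n).
    by exists (q (v + kr (h n) *: g)), g.
  have e0 : 0 < kappa * h n ^+ 2 by rewrite mulr_gt0 // exprn_gt0 // half_pow_gt0.
  have [_ [g gc <-] gmin] := inf_adherent e0 hi.
  have [e Fe ge] := rho_star_adherent (v + kr (h n.+1) *: g) Fz0 (half_pow_gt0 R n).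
  exists (g, e); split=> // g' g'c; apply: le_trans (ltW gmin) _.
  by rewrite lerD2r; apply: ge_inf; [exact: hi.2|exists g'].
have [f fP] := choice step.
pose next n (x : dual Z * seq Z) :=
  (x.1 + kr (h n.+1) *: (f (n, x)).1, (f (n, x)).2 :: x.2).
have [st st0 stS] : exists2 st : nat -> dual Z * seq Z,
    st 0%N = (0, [::]) & forall n, st n.+1 = next n (st n).
  by exists (fix st n := if n is m.+1 then next m (st m) else (0, [::])).
pose e n := (f (n, st n)).2.
have st2 n : forall z, z \in (st n).2 <-> exists2 j, (j < n)%N & z = e j.
  elim: n => [|n IH] z; first by rewrite st0; split=> // -[].
  rewrite stS /= inE; split=> [/orP[/eqP->|/IH[j jn ->]]|[j]].
  - by exists n.
  - by exists j => //; exact: ltnW.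
  - rewrite ltnS leq_eqVlt => /predU1P[-> ->|jn ->]; first by rewrite eqxx.
    by apply/orP; right; apply/IH; exists j.
have candE n g : cand n (st n).2 g <-> slice n e g.
  split=> -[g1 gphi ge]; split=> //.
    by move=> j jn; apply: ge; apply/st2; exists j.
  by move=> z /st2[j jn ->]; exact: ge.
exists (fun n => (f (n, st n)).1), (fun n => (st n).1), e; split=> [|n].
  by rewrite st0.
have [gc gmin Fe qe] := fP (n, st n).
split=> //; rewrite ?stS //.
  exact/candE.
by move=> g' /candE; exact: gmin.
Qed.

Section Contradiction.
(* phi takes the value eps at the sum w of the series, so q w >= 4 kappa. *)
Let kappa := eps / (4 * C).
Let kappa0 : 0 < kappa. Proof. by rewrite divr_gt0 // mulr_gt0 //; lra. Qed.
Variables (g v : nat -> dual Z) (e : nat -> Z).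
Hypothesis v0 : v 0%N = 0.
Hypothesis vS : forall n, v n.+1 = v n + kr (h n.+1) *: g n.
Hypothesis g_slice : forall n, slice n e (g n).
Hypothesis g_min : forall n g', slice n e g' ->
  q (v n + kr (h n) *: g n) <= q (v n + kr (h n) *: g') + kappa * h n ^+ 2.
Hypothesis eF : forall n, sval F (e n).
Hypothesis e_norming : forall n, q (v n.+1) <= rnorm (v n.+1 (e n)) + h n.

Let h0 := @half_pow_gt0 R.

(** The weights of the terms with index between n and m add up to
    2^-n - 2^-m. *)
Lemma series_tail n m z eta : (n <= m)%N -> 0 <= eta ->
  (forall k, (n <= k)%N -> rnorm (g k z) <= eta) ->
  rnorm (v m z - v n z) <= eta * (h n - h m).
Proof.
move=> nm eta0 gz; elim: m nm => [|m IH].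
  by rewrite leqn0 => /eqP ->; rewrite !subrr rnorm0 mulr0.
rewrite leq_eqVlt => /predU1P[->|]; first by rewrite !subrr rnorm0 mulr0.
rewrite ltnS => nm; have := IH nm; rewrite vS dualDE.
have := ler_rnormD (v m z - v n z) ((kr (h m.+1) *: g m) z).
rewrite addrAC dual_realZE ?(ltW (h0 _)) // half_powS.
have := ler_wpM2l (ltW (h0 m)) (gz m nm); lra.
Qed.

Lemma g_bound z k : rnorm (g k z) <= rnorm z.
Proof.
have [g1 _ _] := g_slice k; apply: le_trans (dual_bound (g k) z) _.
by rewrite -[leRHS]mul1r ler_wpM2r ?rnorm_ge0.
Qed.

Lemma series_phi n : phi (v n) = kr (eps * (1 - h n)).
Proof.
elim: n => [|n IH].
  by rewrite v0 (linear_zeroE phi_lin) half_pow0 subrr mulr0 of_real0.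
have [_ gphi _] := g_slice n.
rewrite vS (linear_addE phi_lin) (linear_scaleE phi_lin) IH gphi.
rewrite /GRing.scale /= -of_realM -of_realD half_powS; congr of_real; lra.
Qed.

(** The sum w of the series equals v n + 2^-n t n, where t n is an admissible
    candidate at step n; hence the choice of g n is compared with w at every
    step, which keeps q (v n) below q w by a multiple of 2^-n. *)
Lemma minimizing_sequence_contradiction : False.
Proof.
have [U [UU Uoo]] : exists U : set_system nat, UltraFilter U /\ \oo `<=` U.
  exact: ultraFilterLemma.
have Uge n : U [set k | (n <= k)%N] by apply: Uoo; exists n.
have small (a c : R) : (forall n, a <= c * h n) -> a <= 0.
  move=> ac; rewrite leNgt; apply/negP => a0.
  by have [n] := half_pow_small c a0; have := ac n; lra.
have v_bound n z : rnorm (v n z) <= rnorm z.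
  have := series_tail (leq0n n) (rnorm_ge0 z) (fun k _ => g_bound z k).
  rewrite v0 half_pow0 subr0.
  have := mulr_ge0 (rnorm_ge0 z) (ltW (h0 n)); lra.
have [Phi [lPhi Phi1 vPhi]] := ultra_linear_limit UU (fun n => (dualP (v n)).1)
  (fun z => filterS (fun n _ => v_bound n z) (Uge 0%N)).
have [w wPhi] : exists w : dual Z, forall z, w z = Phi z.
  by apply: (@dual_of_bounded _ _ _ _ 1) => // z; rewrite mul1r.
have vw z : fcvg U (fun n => v n z) (w z) by rewrite wPhi.
have tail n z eta : 0 <= eta ->
    (forall k, (n <= k)%N -> rnorm (g k z) <= eta) ->
    rnorm (w z - v n z) <= eta * h n.
  move=> eta0 gz; apply: fcvg_le (vw z) _; apply: filterS (Uge n) => k /= nk.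
  apply: le_trans (series_tail nk eta0 gz) _.
  by rewrite ler_wpM2l // gerBl ltW.
have tail_norm n : rnorm (w - v n) <= h n.
  apply: dual_le => [|z]; first exact: ltW.
  rewrite dualDE mulrC; apply: tail; first exact: rnorm_ge0.
  by move=> k _; exact: g_bound.
pose t n := kr (h n)^-1 *: (w - v n).
have hV n : 0 <= (h n)^-1 by rewrite invr_ge0 ltW.
have tE n : v n + kr (h n) *: t n = w.
  by rewrite /t scalerA -of_realM mulfV ?gt_eqF // of_real1 scale1r addrC subrK.
have phiw : phi w = kr eps.
  apply/eqP; rewrite -subr_eq0; apply/eqP/(@rnorm_eq0 R s K^o)/eqP.
  rewrite eq_le rnorm_ge0 andbT; apply: (small _ (C + eps)) => n.
  have := ler_rnorm_distD (phi (v n)) (phi w) (kr eps).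
  rewrite -(linear_subE phi_lin).
  have := phi_le (w - v n).
  have := ler_wpM2l (ltW C0) (le_trans (rho_star_le_norm F _) (tail_norm n)).
  have -> : phi (v n) - kr eps = kr (- (eps * h n)).
    by rewrite series_phi -of_realN -of_realD; congr of_real; lra.
  rewrite rnorm_of_real normrN (ger0_norm (mulr_ge0 (ltW eps0) (ltW (h0 n)))); lra.
have t_slice n : slice n e (t n).
  split.
  - rewrite /t rnorm_realZ // ler_pdivrMl // mulr1; exact: tail_norm.
  - rewrite /t (linear_scaleE phi_lin) (linear_subE phi_lin) phiw series_phi.
    rewrite /GRing.scale /= -of_realN -of_realD -of_realM; congr of_real.
    by field; rewrite gt_eqF.
  - move=> j jn; rewrite /t dual_realZE // ler_pdivrMl // dualDE mulrC.
    apply: tail; first exact: ltW.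
    move=> k nk; have [_ _ gk] := g_slice k.
    by apply: le_trans (gk j (leq_trans jn nk)) (half_pow_le R nk).
have s_ge : 4 * kappa <= q w.
  rewrite /kappa; have -> : 4 * (eps / (4 * C)) = eps / C.
    by field; rewrite gt_eqF.
  rewrite ler_pdivrMr // mulrC; have := phi_le w.
  by rewrite phiw rnorm_of_real gtr0_norm.
(* v (n + 1) is the midpoint of v n + 2^-n g n and v n. *)
have gap n : h n * (q w - 2 * kappa + 2 * kappa * h n) <= q w - q (v n).
  elim: n => [|n IH]; first by rewrite v0 seminorm0 half_pow0; lra.
  have := g_min (t_slice n); rewrite tE.
  have := seminormD q (v n + kr (h n) *: g n) (v n).
  have -> : v n + kr (h n) *: g n + v n = kr 2 *: v n.+1.
    rewrite vS scalerDr scalerA -of_realM half_powS mulrCA divff ?mulr1 //.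
    by rewrite [kr 2](of_realD s 1 1) of_real1 scalerDl scale1r addrAC.
  rewrite seminorm_realZ // half_powS.
  set a := q (v n.+1); set b := q (v n + _); set d := h n in IH *; nra.
have gap2 n : 2 * kappa * h n <= q w - q (v n).
  apply: le_trans (gap n); rewrite mulrC ler_pM2l //.
  have := mulr_gt0 kappa0 (h0 n); lra.
have [f Ff ef] : exists2 f, sval F f & forall x : dual Z, fcvg U (x \o e) (x f).
  have eU : U [set n | sval F (e n)] by apply: filterS (Uge 0%N) => n _; exact: eF.
  by have /weakly_compactP/(_ (e @ U) (ultra_fmap e UU) eU) := (svalP F).1.
(* f is a cluster point of nearly norming points, so w attains q w at f. *)
have wf : q w <= rnorm (w f).
  apply/ler_addgt0Pr => eta eta0.
  rewrite -[w f]subr0 -lerBlDr; apply: fcvg_ge (ef w) _.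
  have [N Neta] := half_pow_small 2 eta0.
  apply: filterS (Uge N) => n Nn; rewrite /mkset subr0.
  have hn : h n <= h N by exact: half_pow_le.
  have := e_norming n.
  have := seminormD q (w - v n.+1) (v n.+1); rewrite subrK.
  have := rho_star_ub (w - v n.+1) (eF n).
  have := ler_rnormB (w (e n)) ((w - v n.+1) (e n)).
  have -> : w (e n) - (w - v n.+1) (e n) = v n.+1 (e n).
    by rewrite dualDE opprD addrA subrr add0r opprK.
  have := le_trans (rho_star_le_norm F _) (tail_norm n.+1).
  rewrite half_powS; lra.
have tf n : 2 * kappa <= rnorm (t n f).
  rewrite -(ler_pM2l (h0 n)) /t dual_realZE // [leRHS]mulrA mulfV ?gt_eqF // mul1r.
  rewrite dualDE mulrC; apply: le_trans (gap2 n) _.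
  have := rho_star_ub (v n) Ff; have := ler_rnormD (w f - v n f) (v n f).
  rewrite subrK; lra.
have t_bound n z : rnorm (t n z) <= rnorm z.
  have [t1 _ _] := t_slice n; apply: le_trans (dual_bound (t n) z) _.
  by rewrite -[leRHS]mul1r ler_wpM2r ?rnorm_ge0.
have [Psi [lPsi Psi1 tPsi]] := ultra_linear_limit UU (fun n => (dualP (t n)).1)
  (fun z => filterS (fun n _ => t_bound n z) (Uge 0%N)).
have [x xPsi] : exists x : dual Z, forall z, x z = Psi z.
  by apply: (@dual_of_bounded _ _ _ _ 1) => // z; rewrite mul1r.
(* t n is bounded by 2^-n at e m once m < n. *)
have xe m : x (e m) = 0.
  apply/(@rnorm_eq0 R s K^o)/eqP; rewrite eq_le rnorm_ge0 andbT.
  apply: (small _ 1) => n; rewrite mul1r -[x _]subr0 xPsi.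
  apply: fcvg_le (tPsi _) _.
  apply: filterS (filterI (Uge m.+1) (Uge n)) => k /= [mk nk].
  have [_ _ tk] := t_slice k; rewrite subr0.
  by apply: le_trans (tk m mk) (half_pow_le R nk).
have xf0 : x f = 0.
  apply: fcvg_unique (ef x) _ => d d0; apply: filterS (Uge 0%N) => n _ /=.
  by rewrite xe subrr rnorm0.
have : 2 * kappa <= rnorm (x f - 0).
  rewrite xPsi; apply: fcvg_ge (tPsi f) _.
  by apply: filterS (Uge 0%N) => n _ /=; rewrite subr0; exact: tf.
by rewrite xf0 subrr rnorm0; have := kappa0; lra.
Qed.

End Contradiction.
End Far.

(** The contradiction above excludes a positive distance from phi to the
    evaluations. *)
Lemma near_evaluation eps : 0 < eps ->
  exists z : Z, forall g : dual Z, rnorm (phi g - g z) <= eps * rnorm g.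
Proof.
move=> eps0; apply: contrapT => far.
have phi_far (z : Z) : exists g : dual Z, eps * rnorm g < rnorm (phi g - g z).
  apply: contrapT => near; apply: far; exists z => g.
  by rewrite leNgt; apply/negP => gz; apply: near; exists g.
have kappa0 : 0 < eps / (4 * C) by rewrite divr_gt0 // mulr_gt0 //; lra.
have [g [v [e [v0 /all_and5[vS gs gm eF en]]]]] :=
  minimizing_sequence eps0 phi_far kappa0.
exact: (minimizing_sequence_contradiction eps0 v0 vS gs gm eF en).
Qed.

End MackeyArens.

Section Complete.
Context {R : realType} {s : scalar_kind}.
Local Notation K := (scalar_field R s).

(** Sequences suffice, and are easier to handle in a dual than its uniform
    structure. *)
Definition sequentially_complete (Z : normedModType K) :=
  forall u : nat -> Z,
  (forall e : R, 0 < e -> exists N, forall n m,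
     (N <= n)%N -> (N <= m)%N -> rnorm (u n - u m) <= e) ->
  exists z, forall e : R, 0 < e -> exists N, forall n,
    (N <= n)%N -> rnorm (u n - z) <= e.

(** The Mackey-Arens theorem, by completeness of Z.  Krein's theorem enters
    because q_F is also the supremum over the closed absolutely convex hull
    of F. *)
Theorem rho_star_bounded_eval (Z : normedModType K)
    (F : {F : set Z | wc_in_ball F}) (phi : dual Z -> K^o) (C : R) :
  sequentially_complete Z -> 0 < C -> linear phi ->
  (forall g, rnorm (phi g) <= C * rho_star F g) ->
  exists z : Z, forall g : dual Z, phi g = g z.
Proof.
move=> Zc C0 lphi phiC.
have /choice[u uP] : forall n, exists z : Z, forall g : dual Z,
    rnorm (phi g - g z) <= half_pow R n * rnorm g.
  by move=> n; apply: near_evaluation C0 lphi phiC _ _; exact: half_pow_gt0.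
have [|z uz] := Zc u.
  move=> d d0; have [N Nd] := half_pow_small 2 d0; exists N => n m Nn Nm.
  apply: le_trans (ltW Nd).
  apply: norm_le_dual => [|g]; first by rewrite mulr_ge0 // ltW ?half_pow_gt0.
  rewrite (linear_subE (dualP g).1).
  have := ler_rnorm_distD (phi g) (g (u n)) (g (u m)).
  have := uP n g; rewrite (rnormBC (phi g) (g (u n))); have := uP m g.
  have := ler_wpM2r (rnorm_ge0 g) (half_pow_le R Nn).
  have := ler_wpM2r (rnorm_ge0 g) (half_pow_le R Nm); lra.
exists z => g; apply/eqP; rewrite -subr_eq0; apply/eqP/(@rnorm_eq0 R s K^o)/eqP.
rewrite eq_le rnorm_ge0 andbT; apply/ler_addgt0Pr => d d0; rewrite add0r.
have g0 := rnorm_ge0 g; pose c := d / (2 * (rnorm g + 1)).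
have c0 : 0 < c by rewrite divr_gt0 // mulr_gt0 //; lra.
have cg : c * rnorm g <= d / 2.
  rewrite /c invfM mulrA -[leRHS]mulr1 -mulrA ler_pM2l; last lra.
  by rewrite ler_pdivrMl; lra.
have [N uN] := uz c c0; have [M] := half_pow_small 1 c0; rewrite mul1r => hM.
have := ler_rnorm_distD (g (u (maxn N M))) (phi g) (g z).
have := uP (maxn N M) g; rewrite -(linear_subE (dualP g).1).
have := dual_bound g (u (maxn N M) - z).
have := ler_wpM2l g0 (uN _ (leq_maxl N M)).
have := ler_wpM2r g0 (le_trans (half_pow_le R (leq_maxr N M)) (ltW hM)); lra.
Qed.

End Complete.

(** * Weakly compact sets *)

Section WeaklyCompactSets.
Context {R : realType} {s : scalar_kind}.
Local Notation K := (scalar_field R s).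
Variable Z : normedModType K.

(** The bipolar of C F, that is its closed absolutely convex hull. *)
Definition bipolar (C : R) (F : {F : set Z | wc_in_ball F}) : set Z :=
  [set z | forall g : dual Z, rnorm (g z) <= C * rho_star F g].

(** An ultrafilter on the bipolar has a limit in the bidual, and this limit is
    dominated by C q_F. *)
Lemma bipolar_weakly_compact C F : sequentially_complete Z -> 0 < C ->
  weakly_compact (bipolar C F).
Proof.
move=> Zc C0; apply/weakly_compactP => U UU UB.
have Ule (g : dual Z) : U [set z | rnorm (g z) <= C * rho_star F g].
  by apply: filterS UB => z /(_ g).
have [|phi [lphi phiC Uphi]] :=
    @ultra_linear_limit R s Z U (dual Z) (fun z g => g z) _ UU _ Ule.
  by move=> z; exact: eval_linear.
have [z phiz] := rho_star_bounded_eval Zc C0 lphi phiC.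
by exists z => g; rewrite -phiz.
Qed.

Lemma bipolar0 C F : 0 < C -> bipolar C F 0.
Proof.
move=> C0 g; rewrite (linear_zeroE (dualP g).1) rnorm0.
by rewrite mulr_ge0 ?seminorm_ge0 // ltW.
Qed.

Lemma finite_union_wc_in_ball (J : set {F : set Z | wc_in_ball F}) :
  finite_set J ->
  exists F : {F : set Z | wc_in_ball F}, forall i, J i -> sval i `<=` sval F.
Proof.
case/finite_setP => n; elim: n J => [|n IH] J.
  rewrite II0 card_eq0 => /eqP ->.
  have wc0 : wc_in_ball (set0 : set Z) by split; [exact: compact0|move=> ?].
  by exists (exist _ set0 wc0).
move=> /eq_cardSP[F JF /IH[G JG]].
have wcU : wc_in_ball (sval F `|` sval G).
  have [[cF F1] [cG G1]] := (svalP F, svalP G).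
  by split=> [|z [/F1|/G1]//]; exact: compactU.
exists (exist _ _ wcU) => i Ji z iz /=.
have [Fi|Fi] := pselect (i = F); first by left; rewrite -Fi.
by right; apply: (JG i).
Qed.

Lemma rho_star_mono (F G : {F : set Z | wc_in_ball F}) (g : dual Z) :
  sval F `<=` sval G -> rho_star F g <= rho_star G g.
Proof.
move=> FG; apply: rho_star_le => [|z Fz]; first exact: seminorm_ge0.
exact: rho_star_ub (FG z Fz).
Qed.

(** The unit ball is weakly closed by Hahn-Banach, and scaling is weakly
    continuous. *)
Lemma shrunk_wc_in_ball (A : set Z) (M : R) : 0 < M -> weakly_compact A ->
  wc_in_ball [set z : Z | rnorm z <= 1 /\ A (of_real s M *: z)].
Proof.
move=> M0 /weakly_compactP Ac; split=> [|z []//].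
apply/weakly_compactP => U UU UB.
have UA : U [set z | A (of_real s M *: z)] by apply: filterS UB => z [].
have [z Az Uz] := Ac ((fun z => of_real s M *: z) @ U) (ultra_fmap _ UU) UA.
have MV : of_real s M * of_real s M^-1 = 1.
  by rewrite -of_realM mulfV ?gt_eqF // of_real1.
have Uz' (g : dual Z) : fcvg U g (g (of_real s M^-1 *: z)).
  move=> e e0; have Me0 : 0 < M * e by rewrite mulr_gt0.
  have Ue : U [set x | rnorm (g (of_real s M *: x) - g z) < M * e] by exact: Uz.
  apply: filterS Ue => x; rewrite /mkset.
  rewrite -(linear_subE (dualP g).1) -[X in _ *: x - X]scale1r -MV -scalerA.
  rewrite -scalerBr (linear_scaleE (dualP g).1) rnorm_realZ ?ltW //.
  by rewrite ltr_pM2l // (linear_subE (dualP g).1).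
exists (of_real s M^-1 *: z) => //; split; last by rewrite scalerA MV scale1r.
apply: norm_le_dual => [|g]; first exact: ler01.
have := @fcvg_le _ _ _ U _ g (g (of_real s M^-1 *: z)) 0 (rnorm g) (Uz' g).
rewrite mul1r subr0; apply; apply: filterS UB => x /= [x1 _]; rewrite subr0.
by rewrite rnorm_dual dual_norm_ub.
Qed.

End WeaklyCompactSets.

(** * Completeness *)

Section Completeness.
Context {R : realType} {s : scalar_kind}.
Local Notation K := (scalar_field R s).

Lemma complete_sequentially_complete (Z : completeNormedModType K) :
  sequentially_complete Z.
Proof.
move=> u uC; have : cauchy (u @ \oo).
  apply/cauchy_ballP => e e0.
  have te : e = of_real s (to_real e) by rewrite to_realK // ltW.
  move: e0; rewrite te -(of_real0 R s) lt_of_real => e0.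
  have e2 : 0 < to_real e / 2 by lra.
  have [N uN] := uC _ e2.
  exists (u @` [set n | (N <= n)%N], u @` [set n | (N <= n)%N]).
    by split; exists N => // n Nn; exists n.
  move=> [_ _] [[n /= Nn <-] [m /= Nm <-]].
  rewrite -ball_normE /= -of_rnorm lt_of_real.
  by apply: le_lt_trans (uN _ _ Nn Nm) _; lra.
move=> /cauchy_cvg/cvg_ex[z uz]; exists z => e e0.
have e0' : 0 < of_real s e by rewrite -(of_real0 R s) lt_of_real.
move/cvgrPdist_lt: uz => /(_ _ e0')[N _ uN]; exists N => n Nn.
by have := uN n Nn; rewrite /= -of_rnorm lt_of_real rnormBC => /ltW.
Qed.

Lemma dual_sequentially_complete (X : normedModType K) :
  sequentially_complete (dual X).
Proof.
move=> u uC.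
have [U [UU Uoo]] : exists U : set_system nat, UltraFilter U /\ \oo `<=` U.
  exact: ultraFilterLemma.
have Uge n : U [set k | (n <= k)%N] by apply: Uoo; exists n.
have [N uN] := uC 1 ltr01; pose M := rnorm (u N) + 1.
have uM x : U [set n | rnorm (u n x) <= M * rnorm x].
  apply: filterS (Uge N) => n Nn; rewrite /mkset.
  apply: le_trans (dual_bound _ _) _; rewrite ler_wpM2r ?rnorm_ge0 //.
  rewrite -[u n](subrK (u N)) (le_trans (ler_rnormD _ _)) // addrC lerD2l.
  exact: uN.
have [Phi [lPhi PhiM uPhi]] :=
  ultra_linear_limit UU (fun n => (dualP (u n)).1) uM.
have [z zPhi] := dual_of_bounded lPhi PhiM.
exists z => e e0; have [N' uN'] := uC e e0; exists N' => n N'n.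
apply: dual_le => [|x]; first exact: ltW.
have -> : (u n - z) x = u n x - z x by [].
rewrite rnormBC zPhi; apply: fcvg_le (uPhi x) _.
apply: filterS (Uge N') => m N'm; rewrite /mkset.
have := dual_bound (u m - u n) x; rewrite dualDE => /le_trans; apply.
by rewrite ler_wpM2r ?rnorm_ge0 // uN'.
Qed.

End Completeness.

(** * Oscillation along Cauchy nets *)

Section Nets.
Context {R : realType} {s : scalar_kind}.
Local Notation K := (scalar_field R s).

Lemma le_of_real_gt (x y : \bar R) :
  (forall c : R, (y < c%:E)%E -> (x <= c%:E)%E) -> (x <= y)%E.
Proof.
case: y => [y| |] xc; last 2 first.
- exact: leey.
- case: x xc => [x| |] xc //.
  + have : (x%:E <= (x - 1)%R%:E)%E by apply: xc; exact: ltNyr.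
    by rewrite lee_fin => {}xc; exfalso; lra.
  + by have : (+oo <= (0 : R)%:E)%E by apply: xc; exact: ltNyr.
apply/lee_addgt0Pr => e e0; apply: xc; rewrite lte_fin; lra.
Qed.

Lemma cauchy_netP (V : lmodType K) (I : Type) (p : I -> seminorm V)
    (L : directedSet) (x : L -> V) :
  cauchy ((x : L -> seminorm_space p) @ @tails L) <->
  forall (J : set I) (e : R), finite_set J -> 0 < e ->
    exists n0 : L, forall n m, dle n0 n -> dle n0 m ->
      forall i, J i -> p i (x n - x m) < e.
Proof.
split=> [xC J e fJ e0|xC E [J [e [fJ e0] JE]]].
  have /xC : entourage (seminorm_ball p J e : set (seminorm_space p * _)).
    by exists J; exists e.
  move=> [[A B] /= [[a _ aA] [b _ bB]] AB].
  have [n0 [an0 bn0]] := dle_directed a b.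
  exists n0 => n m n0n n0m i Ji.
  apply: (AB (x n, x m)) => //=; split.
    by apply: aA => /=; exact: dle_trans n0n.
  by apply: bB => /=; exact: dle_trans n0m.
have [n0 n0P] := xC J e fJ e0.
exists (x @` [set n | dle n0 n], x @` [set n | dle n0 n]).
  by split; exists n0 => // n n0n; exists n.
by move=> [_ _] [[n /= n0n <-] [m /= n0m <-]]; apply: JE => i Ji; exact: n0P.
Qed.

Variables (X Y : normedModType K) (I : Type) (p : I -> seminorm X) (T : X -> Y).
Hypothesis T_lin : linear T.

Lemma cont_le (d : R) :
  (forall eta, 0 < eta -> exists (J : set I) (e : R), [/\ finite_set J, 0 < e &
     forall x y, unit_ball x -> unit_ball y ->
       (forall i, J i -> p i (x - y) < e) -> rnorm (T x - T y) <= d + eta]) ->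
  (cont p T <= d%:E)%E.
Proof.
move=> Td; apply: ge_ereal_sup => _ [L [x [x1 xC ->]]].
apply/lee_addgt0Pr => eta eta0; have [J [e [fJ e0 JT]]] := Td eta eta0.
have [n0 n0P] := (cauchy_netP p x).1 xC J e fJ e0.
apply: ge_ereal_inf; eexists; first by exists n0.
apply: ge_ereal_sup => _ [[n m] /= [n0n n0m] <-].
by rewrite -EFinD lee_fin JT // => i; exact: n0P.
Qed.

(** Otherwise choose, for each finite J and e > 0, a vector w violating the
    conclusion.  Each w is paired with 0 in the index set: the net that runs
    through both is Cauchy, since its terms tend to 0, and its image keeps
    oscillating between T w and 0, by more than c. *)
Lemma lt_cont (c : R) : (cont p T < c%:E)%E ->
  exists (J : set I) (e : R), [/\ finite_set J, 0 < e &
    forall x, unit_ball x -> (forall i, J i -> p i x < e) -> rnorm (T x) <= c].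
Proof.
move=> Tc; apply: contrapT => noJ; move: Tc; rewrite ltNge => /negP; apply.
pose D := {Je : set I * R | finite_set Je.1 /\ 0 < Je.2}.
have /choice[w wP] : forall Je : D, exists x : X, [/\ unit_ball x,
    forall i, (sval Je).1 i -> p i x < (sval Je).2 & c < rnorm (T x)].
  move=> [[J e] /= [fJ e0]]; apply: contrapT => nox; apply: noJ.
  exists J, e; split=> // x x1 xe; rewrite leNgt; apply/negP => cx.
  by apply: nox; exists x.
pose mkD J e (fJ : finite_set J) (e0 : 0 < e) : D :=
  exist _ (J, e) (conj fJ e0).
pose le (a b : D * bool) := (sval a.1).1 `<=` (sval b.1).1 /\
  (sval b.1).2 <= (sval a.1).2.
have le_xx a : le a a by split.
have letr a b d : le a b -> le b d -> le a d.
  by move=> [ab ba] [bd db]; split; [exact: subset_trans bd|exact: le_trans ba].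
pose D0 : D * bool := (mkD set0 1 (finite_set0 _) ltr01, true).
have ledir a b : exists d, le a d /\ le b d.
  case: a b => [[[J e] [fJ e0]] x] [[[H d] [fH d0]] y].
  have fJH : finite_set (J `|` H) by rewrite finite_setU.
  have ed0 : 0 < Num.min e d by rewrite lt_min; apply/andP.
  exists (mkD _ _ fJH ed0, true); rewrite /le /=.
  by split; split; rewrite ?ge_min ?lexx ?orbT //.
pose L := DirectedSet le_xx letr D0 ledir.
pose x (a : L) : X := if a.2 then w a.1 else 0.
have x1 a : unit_ball (x a).
  rewrite /x; case: (a.2); first by have [] := wP a.1.
  exact: zero_in_unit_ball.
have xp (a : L) i : (sval a.1).1 i -> p i (x a) < (sval a.1).2.
  rewrite /x; case: (a.2); first by have [_ + _] := wP a.1; apply.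
  by rewrite seminorm0 => _; exact: (svalP a.1).2.
have xC : cauchy ((x : L -> seminorm_space p) @ @tails L).
  apply/cauchy_netP => J e fJ e0.
  have e2 : 0 < e / 2 by lra.
  exists (mkD J _ fJ e2, true) => n m [/= Jn ne] [/= Jm me] i Ji.
  have := xp n i (Jn i Ji); have := xp m i (Jm i Ji).
  have := seminormD (p i) (x n) (- x m).
  have := seminormBC (p i) 0 (x m); rewrite sub0r subr0 => ->; lra.
apply: (@le_trans _ _ (ca (T \o x))); last first.
  by apply: ereal_sup_ubound; exists L, x.
apply: le_ereal_inf_tmp => _ [n0 _ <-].
have [_ _ cw] := wP n0.1.
apply: (@le_trans _ _ (rnorm (T (x (n0.1, true)) - T (x (n0.1, false))))%:E).
  by rewrite lee_fin /x /= (linear_zeroE T_lin) subr0 ltW.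
apply: ereal_sup_ubound.
exists (((n0.1, true) : L), ((n0.1, false) : L)) => //=.
by split; split.
Qed.

End Nets.

(** * The two inequalities for a pairing *)

Section Pairing.
Context {R : realType} {s : scalar_kind}.
Local Notation K := (scalar_field R s).
(* A is a set on which the functionals j v have supremum norm |S v|, and V is
   large enough to norm Z through j. *)
Variables (Z V W : normedModType K) (j : V -> dual Z) (S : V -> W) (A : set Z).
Variable p : {F : set Z | wc_in_ball F} -> seminorm V.
Hypothesis Zc : sequentially_complete Z.
Hypothesis j_lin : linear j.
Hypothesis S_lin : linear S.
Hypothesis j_le : forall v, rnorm (j v) <= rnorm v.
Hypothesis pE : forall F v, p F v = rho_star F (j v).
Hypothesis A0 : A !=set0.
Hypothesis A_bounded : exists B : R, forall a, A a -> rnorm a <= B.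
Hypothesis S_ge : forall v a, A a -> rnorm (j v a) <= rnorm (S v).
Hypothesis S_le : forall v M, 0 <= M ->
  (forall a, A a -> rnorm (j v a) <= M) -> rnorm (S v) <= M.
Hypothesis j_norming : forall z M, 0 <= M ->
  (forall v, rnorm (j v z) <= M * rnorm v) -> rnorm z <= M.

Lemma omega_le_cont : (omega A <= cont p S)%E.
Proof.
apply: le_of_real_gt => c /(lt_cont S_lin)[J [e [fJ e0 JS]]].
have c0 : 0 <= c.
  apply: le_trans (rnorm_ge0 (S 0)) (JS 0 _ _); first exact: zero_in_unit_ball.
  by move=> i _; rewrite seminorm0.
have [F JF] := finite_union_wc_in_ball fJ.
have d0 : 0 < 2 / e by rewrite divr_gt0.
(* The vector v divided by the bracket satisfies the smallness conditions. *)
have S_bound v : rnorm (S v) <= c * (rnorm v + 2 / e * rho_star F (j v)).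
  have [->|v0] := eqVneq v 0.
    rewrite (linear_zeroE S_lin) (linear_zeroE j_lin) seminorm0 !rnorm0.
    by rewrite mulr0 addr0 mulr0.
  have v_gt0 : 0 < rnorm v.
    rewrite lt_neqAle rnorm_ge0 andbT eq_sym.
    by apply: contra v0 => /eqP/rnorm_eq0/eqP.
  have q0 : 0 <= rho_star F (j v) by exact: seminorm_ge0.
  have dq0 := mulr_ge0 (ltW d0) q0.
  set m := _ + _; have m0 : 0 < m by rewrite /m; lra.
  have mV : 0 <= m^-1 by rewrite invr_ge0 ltW.
  rewrite -ler_pdivrMr // mulrC -(rnorm_realZ _ mV) -(linear_scaleE S_lin).
  apply: JS => [|i Ji].
    by rewrite /unit_ball /= rnorm_realZ // ler_pdivrMl // mulr1 /m; lra.
  rewrite seminorm_realZ // ltr_pdivrMl // pE.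
  apply: le_lt_trans (rho_star_mono (j v) (JF i Ji)) _.
  rewrite /m mulrDl mulrAC divfK ?gt_eqF //.
  have := mulr_gt0 v_gt0 e0; lra.
(* Adding 1 makes C positive when c = 0. *)
pose C := c * (2 / e) + 1.
have C0 : 0 < C by have := mulr_ge0 c0 (ltW d0); rewrite /C; lra.
have close a : A a -> exists2 k, bipolar C F k & rnorm (a - k) <= c.
  move=> Aa.
  have [||Phi [lPhi PhiC Phij]] := @hb_extension R s V (dual Z) j (fun v => j v a)
      (scale_seminorm (norm_seminorm V) c0)
      (scale_seminorm (rho_star F) (ltW C0)) j_lin.
  - by move=> b u v; rewrite j_lin.
  - move=> v /=; have := le_trans (S_ge v Aa) (S_bound v).
    have : 0 <= rho_star F (j v) by exact: seminorm_ge0.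
    by rewrite /= /C; lra.
  have [k Phik] := rho_star_bounded_eval Zc C0 lPhi PhiC.
  exists k => [g|]; first by rewrite -Phik; exact: PhiC.
  apply: j_norming => // v; rewrite (linear_subE (dualP (j v)).1) -Phik.
  exact: Phij.
apply: ge_ereal_inf; exists (dhat A (bipolar C F)).
  exists (bipolar C F) => //; split; first by exists 0; exact: bipolar0.
  exact: bipolar_weakly_compact.
apply: ge_ereal_sup => _ [a Aa <-]; have [k Ck ak] := close a Aa.
by apply: ge_ereal_inf; exists (rnorm (a - k))%:E; [exists k|rewrite lee_fin].
Qed.

Lemma cont_le_omega : ((2^-1)%:E * cont p S <= omega A)%E.
Proof.
apply: le_of_real_gt => c /ereal_inf_lt[_ [C [_ Cc] <-] AC].
have near a : A a -> exists2 b, C b & rnorm (a - b) < c.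
  move=> Aa; have : (ereal_inf [set (rnorm (a - b))%:E | b in C] < c%:E)%E.
    by apply: le_lt_trans AC; apply: ereal_sup_ubound; exists a.
  by move=> /ereal_inf_lt[_ [b Cb <-]]; rewrite lte_fin; exists b.
have [a0 Aa0] := A0; have [b0 _ ab0] := near a0 Aa0.
have c0 : 0 < c by apply: le_lt_trans ab0; exact: rnorm_ge0.
have [B AB] := A_bounded.
have B0 : 0 <= B by apply: le_trans (AB a0 Aa0); exact: rnorm_ge0.
(* Points of C within c of A have norm at most M, so they lie in M F. *)
pose M := B + c; have M0 : 0 < M by rewrite /M; lra.
have MV : 0 <= M^-1 by rewrite invr_ge0 ltW.
pose F : {F : set Z | wc_in_ball F} := exist _ _ (shrunk_wc_in_ball M0 Cc).
suff : (cont p S <= (2 * c)%:E)%E.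
  move=> /(lee_wpmul2l (x := (2^-1)%:E)).
  rewrite lee_fin invr_ge0 => /(_ _)/le_trans.
  by apply=> //; rewrite -EFinM lee_fin mulrA mulVf // mul1r.
apply: cont_le => eta eta0; exists [set F], (eta / M); split.
- exact: finite_set1.
- by rewrite divr_gt0.
move=> x y x1 y1 xyF; rewrite -(linear_subE S_lin).
apply: S_le => [|a Aa]; first lra.
have [b Cb ab] := near a Aa.
have Fb : sval F (of_real s M^-1 *: b).
  split; last by rewrite scalerA -of_realM mulfV ?gt_eqF // of_real1 scale1r.
  rewrite rnorm_realZ // ler_pdivrMl // mulr1 /M.
  have := ler_rnormB a (a - b); have := AB a Aa.
  by rewrite opprB addrCA subrr addr0; lra.
have jb : rnorm (j (x - y) b) <= eta.
  have := xyF F erefl; rewrite pE ltr_pdivlMr // mulrC => /ltW; apply: le_trans.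
  rewrite -ler_pdivrMl // -(@rnorm_realZ R s K^o) // -(linear_scaleE (dualP _).1).
  exact: rho_star_ub.
have xy2 : rnorm (j (x - y)) <= 2.
  apply: le_trans (j_le _) _; have := ler_rnormB x y.
  by move: x1 y1; rewrite /unit_ball /=; lra.
have := ler_rnormD (j (x - y) (a - b)) (j (x - y) b).
rewrite -(linear_addE (dualP _).1) subrK.
have := dual_bound (j (x - y)) (a - b).
have := ler_pM (rnorm_ge0 (j (x - y))) (rnorm_ge0 (a - b)) xy2 (ltW ab).
lra.
Qed.

End Pairing.

(** * The operator and its adjoint *)

Section Instances.
Context {R : realType} {s : scalar_kind}.
Local Notation K := (scalar_field R s).

Lemma bidual_eval_subproof (X : normedModType K) (x : X) :
  (fun f : dual X => f x : K^o) \in @dual_pred R s (dual X).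
Proof.
apply/dual_predP; split; first exact: eval_linear.
by exists (rnorm x) => f; rewrite mulrC dual_bound.
Qed.

Definition bidual_eval (X : normedModType K) (x : X) : dual (dual X) :=
  Dual (bidual_eval_subproof x).

Lemma bidual_eval_linear (X : normedModType K) : linear (@bidual_eval X).
Proof. by move=> a x y; apply: dual_inj => f /=; rewrite (dualP f).1. Qed.

Variables (X Y : normedModType K) (T : {linear X -> Y}) (hT : bounded_map T).

Lemma adjoint_linear : linear (adjoint hT).
Proof. by move=> a f g; apply: dual_inj. Qed.

Lemma adjointE (f : dual Y) x : adjoint hT f x = f (T x).
Proof. by []. Qed.

Lemma bounded_map_ge0 :
  exists2 M : R, 0 <= M & forall x, rnorm (T x) <= M * rnorm x.
Proof.
have [M TM] := hT; exists `|M| => // x; apply: le_trans (TM x) _.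
by rewrite ler_wpM2r ?rnorm_ge0 ?ler_norm.
Qed.

(** Elements of A = T^*(B) act on x through T x, and norming functionals on Y show
    that they recover the norm of T x. *)
Lemma adjoint_omega_cont :
  ((2^-1)%:E * cont_rho T <= omega_op (adjoint hT) /\
   omega_op (adjoint hT) <= cont_rho T)%E.
Proof.
have T_lin : linear T by move=> a x y; rewrite linearP.
have [M M0 TM] := bounded_map_ge0.
have dc := @dual_sequentially_complete R s X.
have j_le (x : X) : rnorm (bidual_eval x) <= rnorm x.
  apply: dual_le => [|f]; first exact: rnorm_ge0.
  by rewrite mulrC; exact: (dual_bound f x).
have A0 : (adjoint hT @` @unit_ball R s (dual Y)) !=set0.
  by exists (adjoint hT 0), 0 => //; exact: zero_in_unit_ball.
have AB : exists B : R, forall a,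
    (adjoint hT @` @unit_ball R s (dual Y)) a -> rnorm a <= B.
  exists M => _ [f f1 <-]; apply: dual_le => // x; apply: le_trans (TM x).
  apply: le_trans (dual_bound f _) _; rewrite -[leRHS]mul1r.
  by rewrite ler_wpM2r ?rnorm_ge0.
have S_ge (x : X) a : (adjoint hT @` @unit_ball R s (dual Y)) a ->
    rnorm (bidual_eval x a) <= rnorm (T x).
  move=> [f f1 <-]; apply: le_trans (dual_bound f (T x)) _; rewrite -[leRHS]mul1r.
  by rewrite ler_wpM2r ?rnorm_ge0.
have S_le (x : X) N : 0 <= N -> (forall a,
    (adjoint hT @` @unit_ball R s (dual Y)) a -> rnorm (bidual_eval x a) <= N) ->
    rnorm (T x) <= N.
  move=> _ TN; have [f [f1 <-]] := norming_functional (T x).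
  by apply: (TN (adjoint hT f)); exists f.
have norming (z : dual X) N : 0 <= N ->
    (forall x, rnorm (bidual_eval x z) <= N * rnorm x) -> rnorm z <= N.
  by move=> N0 zN; apply: dual_le.
have pE (F : {F : set (dual X) | wc_in_ball F}) (x : X) :
  rho F x = rho_star F (bidual_eval x) by [].
split; first exact: (cont_le_omega T_lin j_le pE A0 AB S_le).
exact: (omega_le_cont dc (@bidual_eval_linear X) T_lin pE S_ge norming).
Qed.

Lemma omega_cont_adjoint : sequentially_complete Y ->
  ((2^-1)%:E * cont_rho_star (adjoint hT) <= omega_op T /\
   omega_op T <= cont_rho_star (adjoint hT))%E.
Proof.
move=> Yc; have [M M0 TM] := bounded_map_ge0.
have A0 : (T @` @unit_ball R s X) !=set0.
  by exists (T 0), 0 => //; exact: zero_in_unit_ball.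
have AB : exists B : R, forall a,
    (T @` @unit_ball R s X) a -> rnorm a <= B.
  exists M => _ [x x1 <-]; apply: le_trans (TM x) _; rewrite -[leRHS]mulr1.
  by rewrite ler_wpM2l.
have S_ge (f : dual Y) a : (T @` @unit_ball R s X) a ->
    rnorm (f a) <= rnorm (adjoint hT f).
  by move=> [x x1 <-]; rewrite -adjointE rnorm_dual; exact: dual_norm_ub.
have S_le (f : dual Y) N : 0 <= N ->
    (forall a, (T @` @unit_ball R s X) a -> rnorm (f a) <= N) ->
    rnorm (adjoint hT f) <= N.
  move=> N0 fN; rewrite rnorm_dual; apply: dual_norm_le => x x1.
  by apply: fN; exists x.
have id_lin : linear (@id (dual Y)) by [].
have pE (F : {F : set Y | wc_in_ball F}) (f : dual Y) :
  rho_star F f = rho_star F (id f) by [].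
split.
  exact: (cont_le_omega adjoint_linear (fun f => lexx _) pE A0 AB S_le).
exact: (omega_le_cont Yc id_lin adjoint_linear pE S_ge (@norm_le_dual R s Y)).
Qed.

End Instances.

Local Open Scope ereal_scope.

Theorem theorem4p1 (R : realType) (s : scalar_kind)
    (X Y : completeNormedModType (scalar_field R s))
    (T : {linear X -> Y}) (hT : bounded_map T) :
  ((2^-1)%:E * cont_rho T <= omega_op (adjoint hT) /\
   omega_op (adjoint hT) <= cont_rho T) /\
  ((2^-1)%:E * cont_rho_star (adjoint hT) <= omega_op T /\
   omega_op T <= cont_rho_star (adjoint hT)).
Proof.
split; first exact: adjoint_omega_cont.
by apply: omega_cont_adjoint; exact: complete_sequentially_complete.
Qed.
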